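(* Let $G$ be a discrete group such that $f\in\overline{A(G)f}$ for all $f\in A(G)$, where $A(G)$ is the Fourier algebra of $G$ and the closure is in the norm of $A(G)$. Then $A(G)$ is topologically Noetherian if and only if $G$ is countable.
   Context: $A(G)$ is the Fourier algebra of $G$ in the sense of Eymard (a commutative Banach algebra of functions on $G$ under pointwise multiplication). For a Banach algebra $A$, $A^\sharp$ denotes its (conditional) unitisation: $A^\sharp=A$ if $A$ is unital, and $A^\sharp$ is $A$ with an identity adjoined otherwise. A commutative Banach algebra $A$ is topologically Noetherian if for every closed ideal $I$ of $A$ there exist $n\in\mathbb{N}$ and $x_1,\ldots,x_n\in I$ with $I=\overline{A^\sharp x_1+\cdots+A^\sharp x_n}$ (norm closure). *)

(* Defs.v *)
From HB Require Import structures.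
From mathcomp Require Import all_boot all_order all_algebra.
From mathcomp Require Import sesquilinear complex.
From mathcomp Require Import all_classical all_reals ereal.

Set Implicit Arguments.
Unset Strict Implicit.
Unset Printing Implicit Defensive.

Import Order.TTheory GRing.Theory Num.Theory.

Local Open Scope classical_set_scope.
Local Open Scope ring_scope.

(* Modulus as an element of R; the norm of R[i] takes its values in R[i]. *)
Definition cmod (R : realType) (z : R[i]) : R := complex.Re `|z|.

Definition dot_norm (R : realType) (V : lmodType R[i])
    (form : {dot V for Num.conj}) (v : V) : R :=
  Num.sqrt (complex.Re (form v v)).

(* The inner product is linear in its first argument. *)
Record hilbertSpace (R : realType) := HilbertSpace {
  hcarrier :> lmodType R[i];
  inner : {dot hcarrier for Num.conj};
  hcomplete : forall u : nat -> hcarrier,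
    (forall e : R, 0 < e -> exists N : nat,
      forall m n : nat, (N <= m)%N -> (N <= n)%N -> dot_norm inner (u m - u n) < e) ->
    exists l : hcarrier, forall e : R, 0 < e -> exists N : nat,
      forall n : nat, (N <= n)%N -> dot_norm inner (u n - l) < e
}.

Definition hnorm (R : realType) (H : hilbertSpace R) (v : H) : R :=
  dot_norm (inner H) v.

(* Every [urep x] is onto, being inverted by [urep x^-1], hence unitary. *)
Record unitaryRep (R : realType) (G : groupType) (H : hilbertSpace R) :=
  UnitaryRep {
  urep :> G -> H -> H;
  urep_linear : forall (x : G) (c : R[i]) (v w : H),
    urep x (c *: v + w) = c *: urep x v + urep x w;
  urep1 : forall v : H, urep 1%g v = v;
  urepM : forall (x y : G) (v : H), urep (x * y)%g v = urep x (urep y v);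
  urep_inner : forall (x : G) (v w : H),
    inner H (urep x v) (urep x w) = inner H v w
}.

(** The Fourier algebra of a discrete group, following P. Eymard, "L'algèbre de
    Fourier d'un groupe localement compact" (1964): B(G) is the linear span of
    the positive definite functions, normed as the dual of C*(G), and A(G) is
    the closure in B(G) of the functions in B(G) with compact, i.e. finite,
    support. *)

Definition finitely_supported (R : realType) (G : groupType) (a : G -> R[i]) :=
  finite_set [set x | a x != 0].

(* [0 <= z] in R[i] says that z is real and nonnegative. *)
Definition positive_definite (R : realType) (G : groupType) (phi : G -> R[i]) :=
  forall (n : nat) (x : 'I_n -> G) (c : 'I_n -> R[i]),
    0 <= \sum_(i < n) \sum_(j < n)
           c i * Num.conj (c j) * phi ((x j)^-1 * x i)%g.

(* The operator pi(a) = sum_x a(x) pi(x); used for finitely supported a only,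
   since [\sum_(x \in _)] is 0 on infinite supports. *)
Definition rep_alg (R : realType) (G : groupType) (H : hilbertSpace R)
    (pi : unitaryRep G H) (a : G -> R[i]) (v : H) : H :=
  \sum_(x \in [set: G]) a x *: pi x v.

(* The norm of a finitely supported function a in C*(G): the supremum over all
   unitary representations pi of the operator norm of pi(a). *)
Definition cstar_norm (R : realType) (G : groupType) (a : G -> R[i]) : \bar R :=
  ereal_sup [set r | exists (H : hilbertSpace R) (pi : unitaryRep G H) (v : H),
                       hnorm v <= 1 /\ r = (hnorm (rep_alg pi a v))%:E].

Definition fourier_stieltjes (R : realType) (G : groupType) : set (G -> R[i]) :=
  [set u | exists (n : nat) (c : 'I_n -> R[i]) (phi : 'I_n -> G -> R[i]),
     (forall i, positive_definite (phi i)) /\ u = \sum_(i < n) c i *: phi i].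

(* The norm of B(G) = C*(G)^*, by density of the finitely supported functions
   in C*(G). *)
Definition fourier_norm (R : realType) (G : groupType) (u : G -> R[i]) :
    \bar R :=
  ereal_sup [set r | exists a : G -> R[i],
    [/\ finitely_supported a, (cstar_norm a <= 1)%E &
        r = (cmod (\sum_(x \in [set: G]) a x * u x))%:E]].

Definition fourier_algebra (R : realType) (G : groupType) : set (G -> R[i]) :=
  [set u | fourier_stieltjes u /\
     forall e : R, 0 < e -> exists v : G -> R[i],
       [/\ fourier_stieltjes v, finitely_supported v &
           (fourier_norm (u - v)%R < e%:E)%E]].

(** Banach algebras of functions: a set A of complex functions on T, with
    pointwise operations, and its norm N (only its values on A matter). *)

Section BanachFunctionAlgebra.
Context (R : realType) (T : Type).
Implicit Types (A S I : set (T -> R[i])) (N : (T -> R[i]) -> \bar R).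

Definition norm_closure A N S : set (T -> R[i]) :=
  [set f | A f /\ forall e : R, 0 < e ->
                    exists g, S g /\ (N (f - g)%R < e%:E)%E].

Definition closed_ideal A N I :=
  [/\ I `<=` A,
      I 0,
      (forall (c : R[i]) f g, I f -> I g -> I (c *: f + g)),
      (forall a f, A a -> I f -> I (a * f)) &
      norm_closure A N I `<=` I].

Definition has_identity A :=
  exists e, A e /\ forall f, A f -> e * f = f.

(* The conditional unitisation, realised inside the algebra of all functions
   on T: when A has no identity, the constant function 1 is not in A, and
   A + C 1 is A with an identity adjoined. *)
Definition unitisation A : set (T -> R[i]) :=
  [set b | A b \/
     (~ has_identity A /\ exists a (c : R[i]), A a /\ b = a + cst c)].

Definition topologically_noetherian A N :=
  forall I, closed_ideal A N I ->
    exists (n : nat) (x : 'I_n -> T -> R[i]),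
      (forall i, I (x i)) /\
      I = norm_closure A N
            [set f | exists b : 'I_n -> T -> R[i],
               (forall i, unitisation A (b i)) /\ f = \sum_(i < n) b i * x i].

End BanachFunctionAlgebra.

(* Main.v *)
(** Functions with finite support are dense in A(G), and A(G) contains l^1(G).

    If G is countable, let E be the set of points where some member of a closed
    ideal I does not vanish.  Then I contains every finitely supported function
    carried by E, and, choosing positive summable weights w on E, it contains w.
    By the hypothesis on G, each f in I is approximated by functions v f with v
    of finite support; as v f vanishes off E, it is a multiple of w, so w
    generates I topologically.  Conversely, members of A(G) have countable
    supports, and the closed ideal A(G) contains every point mass; if it is
    topologically finitely generated, G is a finite union of supports.

    Both directions use that multiplication by an element of B(G) is bounded,
    i.e. ||phi a||_{C*} <= phi(1) ||a||_{C*} for phi positive definite.  This is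
    reduced, by the Schur product theorem and a Schur complement, to the bound
    sum a(x) conj(a(y)) psi(y^-1 x) <= psi(1) ||a||_{C*}^2 for psi positive
    definite, which is the GNS construction; the GNS space is realised as a
    reproducing kernel Hilbert space of functions on G. *)
Require Import Defs.
From HB Require Import structures.
From mathcomp Require Import all_boot all_order all_algebra.
From mathcomp Require Import sesquilinear spectral complex.
From mathcomp Require Import all_classical all_reals ereal.
From mathcomp Require Import ring lra.

Set Implicit Arguments.
Unset Strict Implicit.
Unset Printing Implicit Defensive.

Import Order.TTheory GRing.Theory Num.Theory.

Local Open Scope classical_set_scope.
Local Open Scope ring_scope.

(** * Positive kernels *)

Section PositiveKernel.
Variable C : numClosedFieldType.

(** A list of pairs (coefficient, point) encodes a formal linear combination. Points may repeat, so
    concatenation is addition and [lscale] is scaling. *)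
Definition kernel_form (X : Type) (K : X -> X -> C) (s t : seq (C * X)) : C :=
  \sum_(p <- s) \sum_(q <- t) p.1 * q.1^* * K p.2 q.2.

Definition psd_kernel (X : Type) (K : X -> X -> C) :=
  forall s, 0 <= kernel_form K s s.

Definition lscale (X : Type) (a : C) (s : seq (C * X)) : seq (C * X) :=
  [seq (a * p.1, p.2) | p <- s].

Variables (X : Type) (K : X -> X -> C).

Lemma kernel_form0r s : kernel_form K s [::] = 0.
Proof. by rewrite /kernel_form big1 // => p _; rewrite big_nil. Qed.

Lemma kernel_formDl s t u :
  kernel_form K (s ++ t) u = kernel_form K s u + kernel_form K t u.
Proof. by rewrite /kernel_form big_cat. Qed.

Lemma kernel_formDr s t u :
  kernel_form K u (s ++ t) = kernel_form K u s + kernel_form K u t.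
Proof.
by rewrite /kernel_form -big_split; apply: eq_bigr => p _; rewrite big_cat.
Qed.

Lemma kernel_formZl a s u :
  kernel_form K (lscale a s) u = a * kernel_form K s u.
Proof.
rewrite /kernel_form big_map mulr_sumr; apply: eq_bigr => p _.
by rewrite mulr_sumr; apply: eq_bigr => q _ /=; rewrite !mulrA.
Qed.

Lemma kernel_formZr a s u :
  kernel_form K u (lscale a s) = a^* * kernel_form K u s.
Proof.
rewrite /kernel_form mulr_sumr; apply: eq_bigr => p _.
rewrite big_map mulr_sumr; apply: eq_bigr => q _ /=.
by rewrite rmorphM; ring.
Qed.

Hypothesis psdK : psd_kernel K.

(** Positivity makes the form at the combination x + b y real for every b. The choices b = 1 and b =
    'i determine the sum and the difference of [K y x] and [K x y]. *)
Lemma psd_kernel_conj x y : K y x = (K x y)^*.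
Proof.
have diag z : (K z z)^* = K z z.
  have := psdK [:: (1, z)]; rewrite /kernel_form !big_seq1 /= rmorph1 !mul1r.
  exact: geC0_conj.
have key b : b * K y x + b^* * K x y = b^* * (K y x)^* + b * (K x y)^*.
  have := psdK [:: (1, x); (b, y)].
  rewrite /kernel_form !big_cons !big_nil /= rmorph1 !mul1r !addr0 !mulr1.
  move=> /geC0_conj; rewrite !(rmorphD, rmorphM) /= conjCK !diag.
  move=> /(congr1 (fun z => z - K x x - b * b^* * K y y)).
  move=> h; rewrite [LHS](_ : _ = K x x + b^* * K x y + (b * K y x + b * b^* * K y y) -
     K x x - b * b^* * K y y); last by ring.
  by rewrite -h; ring.
have := key 1; have := key 'i; rewrite rmorph1 conjCi !mul1r => h1 h2.
have e1 : K y x - K x y = (K x y)^* - (K y x)^*.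
  apply: (mulfI (neq0Ci C)); rewrite !mulrBr; move: h1; rewrite !mulNr => h1.
  by rewrite h1 addrC.
have two0 : 2%:R != 0 :> C by rewrite pnatr_eq0.
apply: (mulfI two0).
rewrite [LHS](_ : _ = (K y x + K x y) + (K y x - K x y)); last by ring.
by rewrite h2 e1; ring.
Qed.

Lemma kernel_form_conj s t : kernel_form K t s = (kernel_form K s t)^*.
Proof.
rewrite /kernel_form rmorph_sum exchange_big /=; apply: eq_bigr => p _.
rewrite rmorph_sum; apply: eq_bigr => q _ /=.
by rewrite !rmorphM /= conjCK psd_kernel_conj; ring.
Qed.

(* Diagonalising the Gram matrix of K writes K as a sum of kernels of the form
   (x, y) |-> d * u x * (u y)^*, with d >= 0. *)
Lemma psd_kernelM (L : X -> X -> C) :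
  psd_kernel L -> psd_kernel (fun x y => K x y * L x y).
Proof.
move=> psdL s; rewrite /kernel_form; set n := size s.
pose x (i : 'I_n) := (tnth (in_tuple s) i).2.
pose c (i : 'I_n) := (tnth (in_tuple s) i).1.
rewrite big_tnth; under eq_bigr do rewrite big_tnth.
rewrite -/n; set S := (X in 0 <= X).
have SE : S = \sum_i \sum_j c i * (c j)^* * (K (x i) (x j) * L (x i) (x j)) by [].
pose A : 'M[C]_n := \matrix_(i, j) K (x i) (x j).
have Aherm : A \is hermsymmx.
  apply/is_hermitianmxP; rewrite expr0 scale1r; apply/matrixP => i j.
  by rewrite !mxE -psd_kernel_conj.
have := hermitian_normalmx Aherm => /orthomx_spectralP.
have := spectral_unitarymx A; set P := spectralmx A => Pu.
set d := spectral_diag A; rewrite (invmx_unitary Pu) => AE.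
have dE : diag_mx d = P *m A *m (P ^t Num.conj)%sesqui.
  have /unitarymxP PP := Pu; rewrite AE !mulmxA PP mul1mx -mulmxA PP.
  by rewrite mulmx1.
(* The eigenvalue [d 0 k] is the form of [K] at the combination whose coefficients are the k-th row
   of [P]. *)
have d_ge0 k : 0 <= d 0 k.
  have -> : d 0 k = diag_mx d k k by rewrite mxE eqxx.
  have := psdK [seq (P k i, x i) | i <- enum 'I_n].
  rewrite /kernel_form big_map big_enum /=.
  under eq_bigr do rewrite big_map big_enum /=.
  rewrite exchange_big /=; congr (_ <= _).
  rewrite dE mxE; apply: eq_bigr => j _; rewrite !mxE mulr_suml.
  by apply: eq_bigr => i _; rewrite !mxE; ring.
have KE i j : K (x i) (x j) = \sum_k d 0 k * (P k i)^* * P k j.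
  transitivity (A i j); first by rewrite mxE.
  rewrite AE mxE; apply: eq_bigr => k _; rewrite mxE (bigD1 k) //= big1.
    by rewrite !mxE eqxx addr0 mulr1n; ring.
  by move=> l lk; rewrite !mxE (negbTE lk) mulr0n mulr0.
(* Each rank-one term of [K] multiplies the coefficients by [(P k i)^*] and leaves the form of
   [L]. *)
have -> : S = \sum_k d 0 k * kernel_form L
     [seq (c i * (P k i)^*, x i) | i <- enum 'I_n]
     [seq (c i * (P k i)^*, x i) | i <- enum 'I_n].
  transitivity (\sum_i \sum_j \sum_k
      d 0 k * (c i * (P k i)^* * (c j * (P k j)^*)^* * L (x i) (x j))).
    rewrite SE; apply: eq_bigr => i _; apply: eq_bigr => j _; rewrite KE.
    rewrite mulr_suml mulr_sumr; apply: eq_bigr => k _.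
    by rewrite rmorphM /= conjCK; ring.
  under eq_bigr do rewrite exchange_big /=.
  rewrite exchange_big /=; apply: eq_bigr => k _.
  rewrite /kernel_form big_map big_enum mulr_sumr; apply: eq_bigr => i _ /=.
  by rewrite big_map big_enum mulr_sumr; apply: eq_bigr => j _.
by apply: sumr_ge0 => k _; apply: mulr_ge0.
Qed.

End PositiveKernel.

(** * Inner products from the parallelogram law *)

Local Open Scope complex_scope.
Local Notation Re := complex.Re.
Local Notation Im := complex.Im.

(** The defect T x - x T 1 is bounded for x >= 0, as subtracting the integer part of x does not
    change it. Replacing x by n x multiplies it by n, so it vanishes by the Archimedean property. *)
Lemma additive_bounded_linear (R : realType) (T : R -> R) (M : R) :
  {morph T : s t / s + t} -> (forall t, 0 <= t <= 1 -> `|T t| <= M) ->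
  forall t, T t = t * T 1.
Proof.
move=> TD bT t.
have T0 : T 0 = 0 by have := TD 0 0; rewrite addr0; lra.
have TN x : T (- x) = - T x by have := TD x (- x); rewrite subrr T0; lra.
have Tn n x : T (n%:R * x) = n%:R * T x.
  elim: n => [|n IH]; first by rewrite !mul0r.
  by rewrite -addn1 natrD !mulrDl TD IH !mul1r.
have Dbnd x : 0 <= x -> `|T x - x * T 1| <= M + `|T 1|.
  move=> x0; have /andP[] := truncn_itv x0; set n := Num.truncn x => nx xn.
  pose r := x - n%:R; have r01 : 0 <= r <= 1.
    by apply/andP; split; rewrite /r; move: xn; rewrite -addn1 natrD; lra.
  have -> : T x - x * T 1 = T r - r * T 1.
    have {1}-> : x = n%:R * 1 + r by rewrite /r; ring.
    by rewrite TD Tn /r; ring.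
  apply: (le_trans (ler_normB _ _)); apply: lerD; first exact: bT.
  rewrite normrM; case/andP: r01 => r0 r1; rewrite (ger0_norm r0).
  by rewrite ler_piMl.
have pos x : 0 <= x -> T x = x * T 1.
  move=> x0; apply/eqP; rewrite -subr_eq0 -normr_le0 leNgt; apply/negP => d0.
  have := archi_boundP (divr_ge0 (le_trans (normr_ge0 _) (Dbnd x x0)) (ltW d0)).
  set n := Num.bound _; rewrite ltr_pdivrMr // => h.
  have := Dbnd (n%:R * x); rewrite mulr_ge0 // => /(_ isT).
  by rewrite Tn -mulrA -mulrBr normrM normr_nat leNgt h.
case: (lerP 0 t) => [/pos //|t0].
by have := @pos (- t); rewrite TN mulNr; lra.
Qed.

Section JordanVonNeumann.
Variables (R : realType) (V : lmodType R[i]) (N : V -> R).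
Hypothesis N_ge0 : forall u, 0 <= N u.
Hypothesis N_para : forall u v, N (u + v) + N (u - v) = 2 * (N u + N v).
Hypothesis NZ : forall c u, N (c *: u) = (Re c ^+ 2 + Im c ^+ 2) * N u.
Hypothesis N_eq0 : forall u, N u = 0 -> u = 0.

Let NN u : N (- u) = N u.
Proof. by rewrite -scaleN1r NZ /= oppr0 sqrrN expr1n expr0n /= addr0 mul1r. Qed.

Let N2 u : N (u + u) = 4 * N u.
Proof. by have := N_para u u; have := NZ 0 u; rewrite subrr scale0r /=; nra. Qed.

(** The real part of the future inner product, polarised from the squared norm [N]. *)
Let S u v := (N (u + v) - N (u - v)) / 4.

Let S_half u u' v : S u v + S u' v = S (u + u') (v + v) / 2.
Proof.
have e1 : (u + v) + (u' + v) = (u + u') + (v + v) by rewrite addrACA.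
have e2 : (u + v) - (u' + v) = u - u' by rewrite opprD addrACA subrr addr0.
have e3 : (u - v) + (u' - v) = (u + u') - (v + v) by rewrite addrACA opprD.
have e4 : (u - v) - (u' - v) = u - u'.
  by rewrite opprD opprK addrACA addNr addr0.
have := N_para (u + v) (u' + v); have := N_para (u - v) (u' - v).
by rewrite e1 e2 e3 e4 /S; lra.
Qed.

Let S0 v : S 0 v = 0.
Proof. by rewrite /S add0r sub0r NN subrr mul0r. Qed.

(** [S_half] is used twice, for the pair u, u' and for the pair u + u', 0; both right-hand sides
    agree. *)
Let SDl u u' v : S (u + u') v = S u v + S u' v.
Proof. by rewrite S_half; have := S_half (u + u') 0 v; rewrite S0 !addr0. Qed.

Let SC u v : S u v = S v u.
Proof. by rewrite /S (addrC u) -(opprB v u) NN. Qed.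

Let S_bound u v : `|S u v| <= (N u + N v) / 2.
Proof.
have := N_para u v; have := N_ge0 (u + v); have := N_ge0 (u - v).
move=> h1 h2 h3; by rewrite ler_norml /S; lra.
Qed.

(** Additivity and the bound [S_bound] for t in [0, 1] give real homogeneity without any continuity
    argument. *)
Let SZr t u v : S (t%:C *: u) v = t * S u v.
Proof.
rewrite (@additive_bounded_linear _ (fun t => S (t%:C *: u) v)
  ((N u + N v) / 2)) ?scale1r // => [a b|a /andP[a0 a1]].
  by rewrite rmorphD scalerDl SDl.
apply: (le_trans (S_bound _ _)); rewrite ler_pM2r ?invr_gt0 // lerD2r NZ /=.
by rewrite expr0n /= addr0 ler_piMl // expr_le1.
Qed.

Let SZi u v : S ('i *: u) ('i *: v) = S u v.
Proof. by rewrite /S -scalerBr -scalerDr !NZ /= expr0n expr1n /= add0r !mul1r. Qed.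

Let SNl u v : S (- u) v = - S u v.
Proof. by have := SDl u (- u) v; rewrite subrr S0; lra. Qed.

Let Sil u v : S ('i *: u) v = - S u ('i *: v).
Proof. by rewrite -SZi scalerA -expr2 sqr_i scaleN1r SNl. Qed.

Let Sc (c : R[i]) u v : S (c *: u) v = Re c * S u v - Im c * S u ('i *: v).
Proof.
have {1}-> : c = (Re c)%:C + (Im c)%:C * 'i by rewrite mulrC -complexE.
by rewrite scalerDl SDl -scalerA !SZr Sil; ring.
Qed.

(** For a form linear in u and conjugate-linear in v, the real part of <u, i v> is the imaginary
    part of <u, v>. *)
Definition jvn_form u v : R[i] := S u v +i* S u ('i *: v).

Let jvn_linear v : scalar (jvn_form ^~ v).
Proof.
move=> c u u'; rewrite /jvn_form !SDl !Sc scalerA -expr2 sqr_i scaleN1r.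
rewrite (SC u (- v)) SNl (SC v u); case: c => a b /=; simpc.
by congr (_ +i* _); ring.
Qed.

Lemma jvn_formC u v : jvn_form v u = (jvn_form u v)^*%R.
Proof. by rewrite /jvn_form (SC v u) (SC v) Sil. Qed.

Lemma jvn_formE u : jvn_form u u = (N u)%:C.
Proof.
have e : S u ('i *: u) = 0 by have := Sil u u; rewrite SC; lra.
have N0 : N 0 = 0 by rewrite -(scale0r u) NZ /= expr0n addr0 mul0r.
by rewrite /jvn_form e /S subrr N2 N0; congr (_ +i* _); field.
Qed.

Let jvn_bilinear : bilinear_for ( *%R : GRing.Scale.law _ _)
  (Num.conj \; *%R : GRing.Scale.law R[i] R[i]) jvn_form.
Proof.
split=> [v|u]; first exact: jvn_linear.
move=> c v v' /=; by rewrite !(jvn_formC _ u) jvn_linear rmorphD rmorphM.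
Qed.

HB.instance Definition _ := bilinear_isBilinear.Build _ _ _ _ _ _ jvn_form
  jvn_bilinear.

Let jvn_hermitian u v : jvn_form u v = (-1) ^+ false * (jvn_form v u)^*%R.
Proof. by rewrite expr0 mul1r jvn_formC. Qed.

HB.instance Definition _ := isHermitianSesquilinear.Build _ _ _ _ jvn_form
  jvn_hermitian.

Let jvn_gt0 u : u != 0 -> 0 < jvn_form u u.
Proof.
move=> u0; rewrite jvn_formE ltcR lt_def N_ge0 andbT.
by apply: contra u0 => /eqP/N_eq0 ->.
Qed.

HB.instance Definition _ := isDotProduct.Build _ _ jvn_form jvn_gt0.

Definition jvn_dot : {dot V for Num.conj} := jvn_form.

Lemma jvn_dotE u v :
  jvn_dot u v = ((N (u + v) - N (u - v)) / 4)
                +i* ((N (u + 'i *: v) - N (u - 'i *: v)) / 4).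
Proof. by []. Qed.

End JordanVonNeumann.

(** * Reproducing kernel Hilbert spaces *)

Section ComplexParts.
Variable R : rcfType.
Implicit Types x y a : R[i].

Lemma ReD x y : Re (x + y) = Re x + Re y. Proof. by case: x => ? ?; case: y. Qed.

Lemma ReN x : Re (- x) = - Re x. Proof. by case: x. Qed.

Lemma ReB x y : Re (x - y) = Re x - Re y. Proof. by rewrite ReD ReN. Qed.

Lemma ImD x y : Im (x + y) = Im x + Im y. Proof. by case: x => ? ?; case: y. Qed.

Lemma ImN x : Im (- x) = - Im x. Proof. by case: x. Qed.

Lemma Re_mul x y : Re (x * y) = Re x * Re y - Im x * Im y.
Proof. by case: x => ? ?; case: y. Qed.

Lemma ReJ x : Re x^*%R = Re x. Proof. by case: x. Qed.

Lemma ImJ x : Im x^*%R = - Im x. Proof. by case: x. Qed.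

Lemma Re_normsqM a x :
  Re (a * (a^*%R * x)) = (Re a ^+ 2 + Im a ^+ 2) * Re x.
Proof.
have -> : a * (a^*%R * x) = (Re a ^+ 2 + Im a ^+ 2)%:C * x.
  by rewrite mulrA add_Re2_Im2 -normCK.
by rewrite Re_mul /= mul0r subr0.
Qed.

Lemma normsqrc a : `|a| ^+ 2 = (Re a ^+ 2 + Im a ^+ 2)%:C.
Proof. by rewrite add_Re2_Im2. Qed.

Lemma complex_ge0P x : reflect (0 <= Re x /\ Im x = 0) (0 <= x).
Proof.
by rewrite lecE /= andbC; apply: (iffP andP) => -[h] => [/eqP|->]; split.
Qed.

Lemma conj_realC (r : R) : (r%:C)^*%R = r%:C. Proof. exact: conjc_real. Qed.

Lemma complex_eq0 x : Re x = 0 -> Im x = 0 -> x = 0.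
Proof. by case: x => a b /= -> ->. Qed.

End ComplexParts.

(** The limit is obtained as a lower limit: the supremum of the reals that are eventually below the
    sequence. *)
Lemma cauchy_real_cvg (R : realType) (u : nat -> R) :
  (forall e : R, 0 < e -> exists N : nat, forall m n : nat,
     (N <= m)%N -> (N <= n)%N -> `|u m - u n| <= e) ->
  exists l : R, forall e : R, 0 < e -> exists N : nat,
    forall n : nat, (N <= n)%N -> `|u n - l| <= e.
Proof.
move=> cu.
pose A := [set a : R | exists N : nat, forall n, (N <= n)%N -> a <= u n].
have bd N e : (forall m n : nat, (N <= m)%N -> (N <= n)%N -> `|u m - u n| <= e) ->
    A (u N - e) /\ ubound A (u N + e).
  move=> hN; split=> [|a [N' hN']].
    by exists N => n Nn; have := hN _ _ (leqnn N) Nn; rewrite ler_norml; lra.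
  have := hN' _ (leq_maxr N N'); have := hN _ _ (leqnn N) (leq_maxl N N').
  by rewrite ler_norml; lra.
have supA : has_sup A.
  by have [N /bd[h1 h2]] := cu 1 ltr01; split; [exists (u N - 1) | exists (u N + 1)].
exists (sup A) => e e0; have [N hN] := cu (e / 2) ltac:(lra).
exists N => n Nn; have [h1 h2] := bd _ _ hN.
have := ub_le_sup supA.2 h1; have := ge_sup supA.1 h2.
by have := hN _ _ (leqnn N) Nn; rewrite !ler_norml; lra.
Qed.

Record psdKernel (R : realType) (X : Type) := PsdKernel {
  pker :> X -> X -> R[i];
  pkerP : psd_kernel pker
}.

(** * The reproducing kernel norm as a supremum of energies *)

Section ReproducingKernel.
Variables (R : realType) (X : Type) (K : psdKernel R X).
Implicit Types (f g : X -> R[i]) (s t : seq (R[i] * X)).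

(** By the reproducing property, this is what the inner product of f with the combination of kernel
    sections \sum q.1 K(q.2, -) has to be. *)
Definition pairing f s : R[i] := \sum_(q <- s) q.1^*%R * f q.2.

(** Formally ||f||^2 - ||f - k||^2, where k is the combination of kernel sections encoded by s; its
    supremum over s is then ||f||^2. *)
Definition rk_energy f s : R :=
  2 * Re (pairing f s) - Re (kernel_form K s s).

Definition rk_bounded : {pred X -> R[i]} :=
  fun f => `[< exists M, forall s, rk_energy f s <= M >].

(* The squared norm of the reproducing kernel Hilbert space is obtained as a
   Legendre transform: its parallelogram law is then an identity between
   energies. *)
Definition rk_sqnorm f : R := sup (range (rk_energy f)).

Lemma pairing_cat f s t : pairing f (s ++ t) = pairing f s + pairing f t.
Proof. by rewrite /pairing big_cat. Qed.

Lemma pairing_lscale a f s : pairing f (lscale a s) = a^*%R * pairing f s.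
Proof.
rewrite /pairing big_map mulr_sumr; apply: eq_bigr => q _ /=.
by rewrite rmorphM mulrA.
Qed.

Lemma pairingP c f g s : pairing (c *: f + g) s = c * pairing f s + pairing g s.
Proof.
rewrite /pairing mulr_sumr -big_split; apply: eq_bigr => q _ /=.
by rewrite (_ : (c *: f + g) q.2 = c * f q.2 + g q.2) //; ring.
Qed.

Lemma pairingD f g s : pairing (f + g) s = pairing f s + pairing g s.
Proof. by rewrite -[f]scale1r pairingP scale1r mul1r. Qed.

Lemma pairingZ c f s : pairing (c *: f) s = c * pairing f s.
Proof.
rewrite -[c *: f]addr0 pairingP (_ : pairing 0 s = 0) ?addr0 //.
by rewrite /pairing big1 // => q _; rewrite (_ : (0 : X -> R[i]) q.2 = 0) ?mulr0.
Qed.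

Lemma rk_energy_sqnorm f s : f \in rk_bounded -> rk_energy f s <= rk_sqnorm f.
Proof.
move=> /asboolP[M hM]; apply: ub_le_sup; last by exists s.
by exists M => _ [t _ <-].
Qed.

Lemma rk_sqnorm_le f M : (forall s, rk_energy f s <= M) -> rk_sqnorm f <= M.
Proof.
move=> hM; apply: ge_sup; first by exists (rk_energy f [::]), [::].
by move=> _ [t _ <-].
Qed.

Lemma rk_bounded_le f M : (forall s, rk_energy f s <= M) -> f \in rk_bounded.
Proof. by move=> h; apply/asboolP; exists M. Qed.

Lemma rk_energy_nil f : rk_energy f [::] = 0.
Proof.
by rewrite /rk_energy kernel_form0r /pairing big_nil /= mulr0 subr0.
Qed.

Lemma kernel_form_Re_ge0 s : 0 <= Re (kernel_form K s s).
Proof. by have /complex_ge0P[] := pkerP K s. Qed.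

Lemma rk_sqnorm_ge0 f : f \in rk_bounded -> 0 <= rk_sqnorm f.
Proof. by move=> bf; rewrite -(rk_energy_nil f) rk_energy_sqnorm. Qed.

Lemma rk_energy0 s : rk_energy 0 s <= 0.
Proof.
rewrite /rk_energy -(scale0r 0) pairingZ mul0r /= mulr0 sub0r oppr_le0.
exact: kernel_form_Re_ge0.
Qed.

Lemma rk_energy_para f g s t :
  rk_energy (f + g) (s ++ t) + rk_energy (f - g) (s ++ lscale (-1) t) =
  2 * rk_energy f s + 2 * rk_energy g t.
Proof.
rewrite /rk_energy -scaleN1r !pairingD !pairingZ !pairing_cat !pairing_lscale.
rewrite !kernel_formDl !kernel_formDr !kernel_formZl !kernel_formZr.
by rewrite rmorphN rmorph1 !mulN1r !opprK !(ReD, ReN); ring.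
Qed.

Lemma rk_energyZ c f s : c != 0 ->
  rk_energy (c *: f) s = (Re c ^+ 2 + Im c ^+ 2) * rk_energy f (lscale c^-1 s).
Proof.
move=> c0; rewrite /rk_energy mulrBr mulrCA -!Re_normsqM.
rewrite pairingZ pairing_lscale kernel_formZl kernel_formZr.
rewrite (mulrA c^*%R) -rmorphM divff // rmorph1 mul1r.
rewrite [_ * (c^-1 * _)]mulrCA mulVKf //.
by rewrite mulrA -rmorphM divff // rmorph1 mul1r.
Qed.

Lemma rk_boundedZ c f : f \in rk_bounded -> c *: f \in rk_bounded.
Proof.
move=> bf; have [->|c0] := eqVneq c 0.
  by rewrite scale0r; apply: rk_bounded_le rk_energy0.
apply: (@rk_bounded_le _ ((Re c ^+ 2 + Im c ^+ 2) * rk_sqnorm f)) => s.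
by rewrite rk_energyZ // ler_wpM2l ?addr_ge0 ?sqr_ge0 ?rk_energy_sqnorm.
Qed.

Lemma rk_boundedD f g :
  f \in rk_bounded -> g \in rk_bounded -> f + g \in rk_bounded.
Proof.
move=> bf bg; apply: (@rk_bounded_le _ (2 * rk_sqnorm f + 2 * rk_sqnorm g)) => s.
(* The kernel term is shared equally between f and g; each half is then an energy at the combination
   s / 2. *)
have half h : 2 * Re (pairing h s) - Re (kernel_form K s s) / 2 =
    2 * rk_energy h (lscale (2^-1)%:C s).
  rewrite /rk_energy pairing_lscale kernel_formZl kernel_formZr.
  by rewrite Re_normsqM Re_mul ReJ ImJ /=; field.
have := half f; have := half g.
have := rk_energy_sqnorm (lscale (2^-1)%:C s) bf.
have := rk_energy_sqnorm (lscale (2^-1)%:C s) bg.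
have -> : rk_energy (f + g) s = 2 * (Re (pairing f s) + Re (pairing g s))
    - Re (kernel_form K s s) by rewrite /rk_energy pairingD ReD.
by lra.
Qed.

Lemma rk_bounded_submod : submod_closed rk_bounded.
Proof.
split=> [|c f g bf bg]; first exact: rk_bounded_le rk_energy0.
exact: rk_boundedD (rk_boundedZ c bf) bg.
Qed.

HB.instance Definition _ :=
  GRing.isSubmodClosed.Build R[i] (X -> R[i]) rk_bounded rk_bounded_submod.

Record rkhs := Rkhs { rk_val :> X -> R[i]; rk_valP : rk_val \in rk_bounded }.

HB.instance Definition _ := [isSub for rk_val].
HB.instance Definition _ := [Choice of rkhs by <:].
HB.instance Definition _ := [SubChoice_isSubLmodule of rkhs by <:].

Lemma rk_sqnormZ c f : f \in rk_bounded ->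
  rk_sqnorm (c *: f) = (Re c ^+ 2 + Im c ^+ 2) * rk_sqnorm f.
Proof.
have le a h : h \in rk_bounded -> a != 0 ->
    rk_sqnorm (a *: h) <= (Re a ^+ 2 + Im a ^+ 2) * rk_sqnorm h.
  move=> bh a0; apply: rk_sqnorm_le => s.
  by rewrite rk_energyZ // ler_wpM2l ?addr_ge0 ?sqr_ge0 ?rk_energy_sqnorm.
move=> bf; have [->|c0] := eqVneq c 0.
  rewrite scale0r /= expr0n addr0 mul0r; apply/le_anti.
  rewrite (rk_sqnorm_le rk_energy0) rk_sqnorm_ge0 //.
  exact: rk_bounded_le rk_energy0.
apply/le_anti; rewrite le //=.
have n0 : 0 <= Re c ^+ 2 + Im c ^+ 2 by rewrite addr_ge0 ?sqr_ge0.
have c1 : c^-1 != 0 by rewrite invr_eq0.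
have := ler_wpM2l n0 (le _ _ (rk_boundedZ c bf) c1); rewrite scalerK //.
rewrite [X in _ <= X -> _]mulrA (_ : _ * (Re c^-1 ^+ 2 + _) = 1) ?mul1r //.
apply: complexI.
by rewrite rmorphM /= -!normsqrc -exprMn -normrM divff // normr1 expr1n.
Qed.

(** The inequality >= comes from [rk_energy_para] on taking suprema over s and t separately. Applied
    to f + g and f - g, it yields the converse. *)
Lemma rk_sqnorm_para f g : f \in rk_bounded -> g \in rk_bounded ->
  rk_sqnorm (f + g) + rk_sqnorm (f - g) = 2 * (rk_sqnorm f + rk_sqnorm g).
Proof.
have ge h k : h \in rk_bounded -> k \in rk_bounded ->
    2 * (rk_sqnorm h + rk_sqnorm k) <= rk_sqnorm (h + k) + rk_sqnorm (h - k).
  move=> bh bk; set M := rk_sqnorm (h + k) + _.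
  have est s t : rk_energy h s + rk_energy k t <= M / 2.
    have := rk_energy_para h k s t.
    have := rk_energy_sqnorm (s ++ t) (rk_boundedD bh bk).
    have := rk_energy_sqnorm (s ++ lscale (-1) t) (rpredB bh bk).
    by rewrite /M; lra.
  have eh t : rk_sqnorm h <= M / 2 - rk_energy k t.
    by apply: rk_sqnorm_le => s; have := est s t; lra.
  have : rk_sqnorm k <= M / 2 - rk_sqnorm h.
    by apply: rk_sqnorm_le => t; have := eh t; lra.
  by lra.
move=> bf bg; apply/le_anti; rewrite ge // andbT.
have := ge _ _ (rk_boundedD bf bg) (rpredB bf bg).
have -> : (f + g) + (f - g) = 2 *: f.
  by rewrite addrACA subrr addr0 scaler_nat.
have -> : (f + g) - (f - g) = 2 *: g.
  by rewrite opprB addrC addrA subrK scaler_nat.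
rewrite !rk_sqnormZ //=; lra.
Qed.

(** Cauchy-Schwarz for evaluation at x, read off from the energy at the single point x with
    coefficient f(x) / L. The summand 1 keeps L positive when [K x x] is 0. *)
Lemma rk_val_bound f x : f \in rk_bounded ->
  Re (f x) ^+ 2 + Im (f x) ^+ 2 <= (Re (K x x) + 1) * rk_sqnorm f.
Proof.
move=> bf; set L := Re (K x x) + 1.
have K0 : 0 <= Re (K x x).
  have := kernel_form_Re_ge0 [:: (1, x)].
  by rewrite /kernel_form !big_seq1 /= rmorph1 !mul1r.
have L0 : 0 < L by rewrite /L; lra.
have := rk_energy_sqnorm [:: ((L^-1)%:C * f x, x)] bf.
rewrite /rk_energy /pairing /kernel_form !big_seq1 /=.
set n := Re (f x) ^+ 2 + Im (f x) ^+ 2.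
have -> : ((L^-1)%:C * f x)^*%R * f x = (L^-1 * n)%:C.
  rewrite rmorphM /= conj_realC -mulrA.
  by rewrite (mulrC _ (f x)) -normCK normsqrc rmorphM.
have -> : (L^-1)%:C * f x * ((L^-1)%:C * f x)^*%R = (L^-1 * L^-1 * n)%:C.
  rewrite -normCK normrM exprMn !normsqrc /= expr0n addr0 -/n expr2.
  by rewrite !rmorphM.
rewrite Re_mul /= mul0r subr0 => h.
have nE : L^-1 * n * L = n by rewrite mulrAC mulVf ?mul1r // gt_eqF.
have n0 : 0 <= L^-1 * n.
  by rewrite mulr_ge0 ?invr_ge0 ?(ltW L0) ?addr_ge0 ?sqr_ge0.
rewrite -nE mulrC ler_pM2l //; apply: le_trans h.
have : L^-1 * L^-1 * n * Re (K x x) <= L^-1 * L^-1 * n * L.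
  rewrite ler_wpM2l /L ?lerDl // -mulrA mulr_ge0 // invr_ge0; exact: ltW.
have -> : L^-1 * L^-1 * n * L = L^-1 * n by rewrite -(mulrA L^-1) -mulrA nE.
by lra.
Qed.

Lemma rk_sqnorm_eq0 f : f \in rk_bounded -> rk_sqnorm f = 0 -> f = 0.
Proof.
move=> bf f0; apply/funext => x.
have := rk_val_bound x bf; rewrite f0 mulr0 => h.
have := sqr_ge0 (Re (f x)); have := sqr_ge0 (Im (f x)) => h1 h2.
by apply: complex_eq0; apply/eqP; rewrite -sqrf_eq0; apply/eqP; lra.
Qed.

(** Norm-Cauchy sequences converge pointwise by [rk_val_bound]. An energy involves finitely many
    values only, so bounds on energies pass to the pointwise limit. *)
Lemma rk_complete (u : nat -> X -> R[i]) : (forall n, u n \in rk_bounded) ->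
  (forall e : R, 0 < e -> exists N : nat, forall m n : nat,
    (N <= m)%N -> (N <= n)%N -> rk_sqnorm (u m - u n) <= e) ->
  exists2 l, l \in rk_bounded &
  forall e : R, 0 < e -> exists N : nat, forall n : nat,
    (N <= n)%N -> rk_sqnorm (u n - l) <= e.
Proof.
move=> bu cu.
have cpt x (P : R[i] -> R) : {morph P : y z / y - z} ->
    (forall z, `|P z| ^+ 2 <= Re z ^+ 2 + Im z ^+ 2) ->
    exists l : R, forall e : R, 0 < e -> exists N : nat,
      forall n : nat, (N <= n)%N -> `|P (u n x) - l| <= e.
  move=> PB Ple; apply: cauchy_real_cvg => e e0.
  have K0 : 0 < Re (K x x) + 1.
    have := kernel_form_Re_ge0 [:: (1, x)].
    by rewrite /kernel_form !big_seq1 /= rmorph1 !mul1r; lra.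
  have [|N hN] := cu (e ^+ 2 / (Re (K x x) + 1)).
    by rewrite divr_gt0 // exprn_gt0.
  exists N => m n Nm Nn; rewrite -(ler_pXn2r (ltn0Sn 1)) ?nnegrE ?(ltW e0) //.
  rewrite -PB; apply: (le_trans (Ple _)).
  have := rk_val_bound x (rpredB (bu m) (bu n)) => h; apply: (le_trans h).
  by rewrite mulrC -ler_pdivlMr // hN.
have /choice[re hre] : forall x, exists l : R, forall e : R, 0 < e ->
    exists N : nat, forall n, (N <= n)%N -> `|Re (u n x) - l| <= e.
  move=> x; apply: (cpt x (@complex.Re R)) => [y z|z].
    by rewrite ReB.
  by rewrite -normrX ger0_norm ?sqr_ge0 // lerDl sqr_ge0.
have /choice[im him] : forall x, exists l : R, forall e : R, 0 < e ->
    exists N : nat, forall n, (N <= n)%N -> `|Im (u n x) - l| <= e.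
  move=> x; apply: (cpt x (@complex.Im R)) => [y z|z].
    by rewrite ImD ImN.
  by rewrite -normrX ger0_norm ?sqr_ge0 // lerDr sqr_ge0.
pose l x := re x +i* im x.
have cl s (e : R) : 0 < e -> exists N : nat, forall n, (N <= n)%N ->
    `|Re (pairing (u n - l) s)| <= e.
  elim: s e => [|[c x] s IH] e e0.
    by exists 0 => n _; rewrite /pairing big_nil normr0 ltW.
  have [N1 hN1] := IH (e / 2) ltac:(lra).
  pose d := e / 4 / (`|Re c| + `|Im c| + 1).
  have c0 : 0 < `|Re c| + `|Im c| + 1.
    by have := normr_ge0 (Re c); have := normr_ge0 (Im c); lra.
  have d0 : 0 < d by rewrite !divr_gt0.
  have [N2 hN2] := hre x d d0; have [N3 hN3] := him x d d0.
  exists (maxn N1 (maxn N2 N3)) => n; rewrite !geq_max => /and3P[n1 n2 n3].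
  rewrite /pairing big_cons /= -/(pairing _ s) ReD Re_mul ReJ ImJ.
  rewrite (_ : (u n - l) x = u n x - l x) // ReB ImD ImN /=.
  have := hN1 _ n1; have := hN2 _ n2; have := hN3 _ n3 => h3 h2 h1.
  apply: (le_trans (ler_normD _ _)).
  suff : `|Re c * (Re (u n x) - re x) - - Im c * (Im (u n x) - im x)| <= e / 2.
    by lra.
  rewrite mulNr opprK; apply: (le_trans (ler_normD _ _)); rewrite !normrM.
  have := ler_wpM2l (normr_ge0 (Re c)) h2.
  have := ler_wpM2l (normr_ge0 (Im c)) h3.
  have : (`|Re c| + `|Im c| + 1) * d = e / 4.
    by rewrite /d mulrC divfK // gt_eqF.
  by lra.
(* The index [N] serves all s at once; only the auxiliary index m depends on s. This uniformity
   bounds the supremum. *)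
have lim (e : R) : 0 < e -> exists N : nat, forall n, (N <= n)%N ->
    forall s, rk_energy (u n - l) s <= e.
  move=> e0; have [N hN] := cu (e / 2) ltac:(lra).
  exists N => n Nn s; have [M hM] := cl s (e / 4) ltac:(lra).
  pose m := maxn N M; have := hM m (leq_maxr _ _).
  have := le_trans (rk_energy_sqnorm s (rpredB (bu n) (bu m)))
    (hN _ _ Nn (leq_maxl N M)).
  have -> : u n - l = (u n - u m) + (u m - l) by rewrite addrA subrK.
  by rewrite /rk_energy (pairingD _ (u m - l)) ReD ler_norml; lra.
have bl : l \in rk_bounded.
  have [N hN] := lim 1 ltr01.
  rewrite -(subKr (u N) l); apply: rpredB => //.
  exact: rk_bounded_le (hN N (leqnn N)).
exists l => // e /lim[N hN]; exists N => n Nn.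
by apply: rk_sqnorm_le; apply: hN.
Qed.

End ReproducingKernel.

(** * The GNS construction *)

Section RkhsHilbert.
Variables (R : realType) (X : Type) (K : psdKernel R X).

Let sqn (f : rkhs K) : R := rk_sqnorm K f.

Let sqn_ge0 f : 0 <= sqn f.
Proof. exact: rk_sqnorm_ge0 (rk_valP f). Qed.

Let sqn_para f g : sqn (f + g) + sqn (f - g) = 2 * (sqn f + sqn g).
Proof. exact: rk_sqnorm_para (rk_valP f) (rk_valP g). Qed.

Let sqnZ c f : sqn (c *: f) = (Re c ^+ 2 + Im c ^+ 2) * sqn f.
Proof. exact: rk_sqnormZ (rk_valP f). Qed.

Let sqn_eq0 f : sqn f = 0 -> f = 0.
Proof. by move=> f0; apply/val_inj; exact: rk_sqnorm_eq0 (rk_valP f) f0. Qed.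

Definition rk_dot : {dot rkhs K for Num.conj} :=
  jvn_dot sqn_ge0 sqn_para sqnZ sqn_eq0.

Lemma rk_dotE (f g : rkhs K) :
  rk_dot f g = ((rk_sqnorm K (f + g) - rk_sqnorm K (f - g)) / 4) +i*
    ((rk_sqnorm K (f + 'i *: g) - rk_sqnorm K (f - 'i *: g)) / 4).
Proof. exact: jvn_dotE. Qed.

Lemma rk_dot_sqnorm (f : rkhs K) : rk_dot f f = (rk_sqnorm K f)%:C.
Proof. exact: jvn_formE. Qed.

Lemma rk_dot_norm (f : rkhs K) : dot_norm rk_dot f = Num.sqrt (rk_sqnorm K f).
Proof. by rewrite /dot_norm rk_dot_sqnorm. Qed.

Let rk_hcomplete (u : nat -> rkhs K) :
  (forall e : R, 0 < e -> exists N : nat, forall m n : nat,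
    (N <= m)%N -> (N <= n)%N -> dot_norm rk_dot (u m - u n) < e) ->
  exists l : rkhs K, forall e : R, 0 < e -> exists N : nat,
    forall n : nat, (N <= n)%N -> dot_norm rk_dot (u n - l) < e.
Proof.
move=> cu.
have [||l bl hl] := @rk_complete _ _ K (fun n => u n).
- by move=> n; apply: rk_valP.
- move=> e e0; have [|N hN] := cu (Num.sqrt e); first by rewrite sqrtr_gt0.
  exists N => m n Nm Nn; have := hN _ _ Nm Nn.
  by rewrite rk_dot_norm ltr_sqrt // => /ltW.
exists (Rkhs bl) => e e0; have [|N hN] := hl (e ^+ 2 / 2).
  by rewrite divr_gt0 ?exprn_gt0.
exists N => n Nn; rewrite rk_dot_norm -[e]gtr0_norm // -sqrtr_sqr ltr_sqrt.
  have e2 : 0 < e ^+ 2 by rewrite exprn_gt0.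
  by apply: le_lt_trans (hN _ Nn) _; lra.
by rewrite exprn_gt0.
Qed.

Definition rk_hilbert : hilbertSpace R := HilbertSpace rk_hcomplete.

Definition rk_comb (t : seq (R[i] * X)) (y : X) : R[i] :=
  \sum_(p <- t) p.1 * K p.2 y.

Lemma pairing_rk_comb s t : pairing (rk_comb t) s = kernel_form K t s.
Proof.
rewrite /pairing /kernel_form exchange_big /=; apply: eq_bigr => q _.
by rewrite mulr_sumr; apply: eq_bigr => p _; ring.
Qed.

(** This is positivity of the form at t - s, expanded. Equality holds at s = t, whence
    [rk_sqnorm_comb]. *)
Lemma rk_energy_comb_le s t :
  rk_energy K (rk_comb t) s <= Re (kernel_form K t t).
Proof.
rewrite /rk_energy pairing_rk_comb.
have := kernel_form_Re_ge0 K (t ++ lscale (-1) s).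
rewrite kernel_formDl !kernel_formDr !kernel_formZl !kernel_formZr.
rewrite rmorphN rmorph1 !mulN1r opprK !(ReD, ReN).
have -> : Re (kernel_form K s t) = Re (kernel_form K t s).
  by rewrite (kernel_form_conj (@pkerP _ _ K) t s) ReJ.
by lra.
Qed.

Lemma rk_comb_bounded t : rk_comb t \in rk_bounded K.
Proof. exact: rk_bounded_le (rk_energy_comb_le ^~ t). Qed.

Lemma rk_sqnorm_comb t : rk_sqnorm K (rk_comb t) = Re (kernel_form K t t).
Proof.
apply/le_anti; rewrite (rk_sqnorm_le (rk_energy_comb_le ^~ t)) /=.
have := rk_energy_sqnorm t (rk_comb_bounded t).
by rewrite /rk_energy pairing_rk_comb; apply: le_trans; lra.
Qed.

End RkhsHilbert.

Lemma fsum_seq (V : nmodType) (T : choiceType) (F : T -> V) (r : seq T) :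
  uniq r -> (forall x, F x != 0 -> x \in r) ->
  \sum_(x \in [set: T]) F x = \sum_(x <- r) F x.
Proof.
move=> ur hr; rewrite [RHS]fsbig_seq //; symmetry; apply: fsbig_widen => // x [_ /= xr].
by apply/eqP; apply: contra_notT xr; apply: hr.
Qed.

(** * Positive definite functions and the unit ball of C*(G) *)

Section PositiveDefinite.
Variables (R : realType) (G : groupType).
Implicit Types (phi psi a : G -> R[i]).

Lemma positive_definiteP phi :
  positive_definite phi <-> psd_kernel (fun x y => phi (y^-1 * x)%g).
Proof.
split=> [pphi s|pphi n x c].
  rewrite /kernel_form big_tnth; under eq_bigr do rewrite big_tnth.
  exact: (pphi _ (fun i => (tnth (in_tuple s) i).2)
    (fun i => (tnth (in_tuple s) i).1)).
have := pphi [seq (c i, x i) | i <- enum 'I_n].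
rewrite /kernel_form big_map big_enum /=.
by under eq_bigr do rewrite big_map big_enum /=.
Qed.

Lemma positive_definite_ge0 phi : positive_definite phi -> 0 <= phi 1%g.
Proof.
move=> /positive_definiteP/(_ [:: (1, 1%g)]).
by rewrite /kernel_form !big_seq1 /= rmorph1 !mul1r mulVg.
Qed.

Lemma rep_algE (H : hilbertSpace R) (pi : unitaryRep G H) a v r :
  uniq r -> (forall x, a x != 0 -> x \in r) ->
  rep_alg pi a v = \sum_(x <- r) a x *: pi x v.
Proof.
move=> ur hr; apply: fsum_seq => // x ax; apply: hr.
by apply: contraNneq ax => ->; rewrite scale0r.
Qed.

Lemma finitely_supported_seq a : finitely_supported a ->
  exists2 r, uniq r & forall x, a x != 0 -> x \in r.
Proof.
move=> /finite_seqP[s sE]; exists (undup s) => [|x ax]; first exact: undup_uniq.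
by rewrite mem_undup; have : [set` s] x by rewrite -sE.
Qed.

Lemma hnorm_le1 (H : hilbertSpace R) (v : H) :
  (hnorm v <= 1) = (Re (inner H v v) <= 1).
Proof.
rewrite /hnorm /dot_norm -{1}sqrtr1 ler_sqrt ?ler01 //.
Qed.

Lemma cstar_norm_le1 a : (cstar_norm a <= 1)%E <->
  forall (H : hilbertSpace R) (pi : unitaryRep G H) (v : H),
    Re (inner H v v) <= 1 ->
    Re (inner H (rep_alg pi a v) (rep_alg pi a v)) <= 1.
Proof.
split=> [a1 H pi v v1|ha].
  rewrite -hnorm_le1 -lee_fin; apply: le_trans a1; apply: ereal_sup_ubound.
  by exists H, pi, v; rewrite hnorm_le1.
apply: ge_ereal_sup => _ [H [pi [v [v1 ->]]]].
by rewrite lee_fin hnorm_le1 ha // -hnorm_le1.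
Qed.

(** By homogeneity v may be normalised; the case v = 0 is treated apart. *)
Lemma cstar_norm_contraction a (H : hilbertSpace R) (pi : unitaryRep G H) v :
  finitely_supported a -> (cstar_norm a <= 1)%E ->
  Re (inner H (rep_alg pi a v) (rep_alg pi a v)) <= Re (inner H v v).
Proof.
move=> /finitely_supported_seq[r ur hr] /cstar_norm_le1 a1.
have piZ x c w : pi x (c *: w) = c *: pi x w.
  have p0 : pi x 0 = 0.
    by have := urep_linear pi x (-1) 0 0; rewrite scaler0 addr0 scaleN1r addNr.
  by have := urep_linear pi x c w 0; rewrite p0 !addr0.
have aZ c w : rep_alg pi a (c *: w) = c *: rep_alg pi a w.
  rewrite !(rep_algE _ _ ur hr) scaler_sumr; apply: eq_bigr => x _.
  by rewrite piZ !scalerA mulrC.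
have nZ t w : Re (inner H (t%:C *: w) (t%:C *: w)) = t ^+ 2 * Re (inner H w w).
  by rewrite dnormZ normsqrc Re_mul /= expr0n addr0 mul0r subr0.
have v0 : 0 <= inner H v v := dnorm_ge0 _ _.
have [/eqP|n0] := eqVneq (Re (inner H v v)) 0.
  move=> /eqP n0; have : inner H v v == 0.
    by apply/eqP/complex_eq0 => //; have /complex_ge0P[] := v0.
  rewrite dnorm_eq0 => /eqP ->.
  by rewrite -[X in rep_alg pi a X](scale0r v) aZ scale0r linear0l.
have n1 : 0 < Re (inner H v v).
  by rewrite lt_def n0; have /complex_ge0P[] := v0.
pose t := (Num.sqrt (Re (inner H v v)))^-1.
have t2 : t ^+ 2 = (Re (inner H v v))^-1.
  by rewrite exprVn sqr_sqrtr // ltW.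
have := a1 H pi (t%:C *: v); rewrite aZ !nZ t2 mulVf // lexx => /(_ isT).
by rewrite ler_pdivrMl // mulr1.
Qed.

End PositiveDefinite.

(** * The translation representation attached to a positive definite function *)

Section Gns.
Variables (R : realType) (G : groupType) (psi : G -> R[i]).
Hypothesis pd_psi : positive_definite psi.

Let K : psdKernel R G := PsdKernel (proj1 (positive_definiteP psi) pd_psi).

Let shift (x : G) (s : seq (R[i] * G)) := [seq (p.1, x * p.2)%g | p <- s].

(** The kernel psi(y^-1 x) is invariant under left translation, so translating f amounts to
    translating the test combination back. Translations are therefore isometric. *)
Let energy_shift x f s :
  rk_energy K (fun y => f (x^-1 * y)%g) s = rk_energy K f (shift x^-1%g s).
Proof.
rewrite /rk_energy /pairing /kernel_form !big_map /=; congr (_ - Re _).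
apply: eq_bigr => p _; rewrite big_map; apply: eq_bigr => q _ /=.
by rewrite invgM invgK mulgA mulgK.
Qed.

Let shift_bounded x (f : rkhs K) : (fun y => f (x^-1 * y)%g) \in rk_bounded K.
Proof.
apply: (@rk_bounded_le _ _ _ _ (rk_sqnorm K f)) => s.
by rewrite energy_shift; apply: rk_energy_sqnorm (rk_valP f).
Qed.

Let act x (f : rkhs K) : rkhs K := Rkhs (shift_bounded x f).

Let act1 f : act 1%g f = f.
Proof. by apply/val_inj/funext => y /=; rewrite invg1 mul1g. Qed.

Let actM x y f : act (x * y)%g f = act x (act y f).
Proof. by apply/val_inj/funext => z /=; rewrite invgM mulgA. Qed.

Let act_linear x (c : R[i]) f g : act x (c *: f + g) = c *: act x f + act x g.
Proof. exact/val_inj. Qed.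

Let sqnorm_act_le x f : rk_sqnorm K (act x f) <= rk_sqnorm K f.
Proof.
apply: rk_sqnorm_le => s.
by rewrite /= energy_shift; apply: rk_energy_sqnorm (rk_valP f).
Qed.

Let sqnorm_act x f : rk_sqnorm K (act x f) = rk_sqnorm K f.
Proof.
apply/le_anti; rewrite sqnorm_act_le /= -{1}(act1 f) -(mulVg x) actM.
exact: sqnorm_act_le.
Qed.

Let act_inner x (f g : rk_hilbert K) :
  inner (rk_hilbert K) (act x f) (act x g) = inner (rk_hilbert K) f g.
Proof.
have sD (c : R[i]) :
    rk_sqnorm K (act x f + c *: act x g) = rk_sqnorm K (f + c *: g :> rkhs K).
  by rewrite addrC -act_linear sqnorm_act addrC.
change (rk_dot K (act x f) (act x g) = rk_dot K f g).
rewrite !rk_dotE; have := sD 1; have := sD (-1); have := sD 'i; have := sD (- 'i).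
by rewrite !scaleNr !scale1r => -> -> -> ->.
Qed.

Definition gns_rep : unitaryRep G (rk_hilbert K) :=
  @UnitaryRep R G (rk_hilbert K) act act_linear act1 actM act_inner.

(** The cyclic vector [xi] is the kernel section at 1, of squared norm psi(1). Its translate by x is
    the section at x, so the left-hand side is the squared norm of pi(a) xi. *)
Lemma gns_bound (a : G -> R[i]) r : uniq r ->
  (forall x, a x != 0 -> x \in r) -> (cstar_norm a <= 1)%E ->
  Re (\sum_(x <- r) \sum_(y <- r) a x * (a y)^*%R * psi (y^-1 * x)%g) <=
  Re (psi 1%g).
Proof.
move=> ur hr a1; pose xi : rkhs K := Rkhs (rk_comb_bounded K [:: (1, 1%g)]).
have fa : finitely_supported a.
  by apply: sub_finite_set (finite_seq r) => x; apply: hr.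
have := cstar_norm_contraction gns_rep xi fa a1.
pose s := [seq (a x, x) | x <- r].
have -> : rep_alg gns_rep a xi = Rkhs (rk_comb_bounded K s) :> rkhs K.
  rewrite (rep_algE _ _ ur hr); apply/val_inj; rewrite raddf_sum /=.
  apply/funext => y; rewrite fct_sumE /rk_comb big_map; apply: eq_bigr => x _.
  transitivity (a x * rk_comb K [:: (1, 1%g)] (x^-1 * y)%g); first by [].
  rewrite /rk_comb big_seq1 /= mul1r; congr (_ * psi _).
  by rewrite invgM invgK mulg1.
rewrite !rk_dot_sqnorm !rk_sqnorm_comb /= /kernel_form !big_seq1 /=.
rewrite rmorph1 !mul1r mulVg big_map.
by under eq_bigr do rewrite big_map.
Qed.

End Gns.

(** * Products of positive definite functions *)

Section KernelExamples.
Variable R : realType.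

Lemma psd_kernel_gram (X : Type) (H : hilbertSpace R) (v : X -> H) :
  psd_kernel (fun x y => inner H (v x) (v y)).
Proof.
move=> s; rewrite [X in 0 <= X](_ : _ =
    inner H (\sum_(p <- s) p.1 *: v p.2) (\sum_(p <- s) p.1 *: v p.2)).
  exact: dnorm_ge0.
rewrite linear_sumlz; apply: eq_bigr => p _.
rewrite linear_sumr; apply: eq_bigr => q _.
by rewrite linearZl_LR linearZr_LR /=; ring.
Qed.

(** Since points may repeat in s, the coefficients at each point t are first collected into [c t];
    the form is then \sum |c t|^2. *)
Lemma psd_kernel_eq (X : eqType) :
  psd_kernel (fun x y : X => (x == y)%:R : R[i]).
Proof.
move=> s; rewrite /kernel_form; pose T := undup [seq p.2 | p <- s].
pose c t : R[i] := \sum_(p <- s) p.1 * (p.2 == t)%:R.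
rewrite [X in 0 <= X](_ : _ = \sum_(t <- T) c t * (c t)^*%R).
  by apply: sumr_ge0 => t _; rewrite mul_conjC_ge0.
under [RHS]eq_bigr => t _.
  rewrite /c rmorph_sum mulr_suml; under eq_bigr do rewrite mulr_sumr.
  over.
rewrite [RHS]exchange_big /=; apply: eq_big_seq => p ps.
rewrite exchange_big /=; apply: eq_bigr => q _.
rewrite (bigD1_seq p.2) ?undup_uniq ?mem_undup ?map_f //= big1 => [|t tp].
  by rewrite rmorphM rmorph_nat eqxx mulr1 addr0 eq_sym mulrA.
by rewrite eq_sym (negbTE tp) mulr0 mul0r.
Qed.

End KernelExamples.

(** * Schur products and multiplication on C*(G) *)

Section PositiveDefiniteFunctions.
Variables (R : realType) (G : groupType).
Implicit Types (phi psi a h : G -> R[i]).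

Lemma positive_definiteM phi psi : positive_definite phi ->
  positive_definite psi -> positive_definite (phi * psi).
Proof.
move=> /positive_definiteP p1 /positive_definiteP p2; apply/positive_definiteP.
exact: psd_kernelM p1 _ p2.
Qed.

(** Unitarity rewrites the kernel as the Gram kernel of the vectors pi(x) v. *)
Lemma positive_definite_coef (H : hilbertSpace R) (pi : unitaryRep G H) v :
  positive_definite (fun x => inner H (pi x v) v).
Proof.
apply/positive_definiteP => s.
have := psd_kernel_gram (fun x => pi x v) s; congr (_ <= _).
apply: eq_bigr => p _; apply: eq_bigr => q _; congr (_ * _).
by rewrite -(urep_inner pi q.2 (pi (q.2^-1 * p.2)%g v)) -urepM mulVKg.
Qed.

Lemma positive_definite_eq1 :
  positive_definite (fun x : G => (x == 1%g)%:R : R[i]).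
Proof.
apply/positive_definiteP => s.
have := @psd_kernel_eq R G s; congr (_ <= _).
apply: eq_bigr => p _; apply: eq_bigr => q _; congr (_ * _).
suff -> : (q.2^-1 * p.2 == 1)%g = (p.2 == q.2) by [].
by apply/eqP/eqP => [e|->]; rewrite ?mulVg // -[RHS]mulg1 -e mulVKg.
Qed.

(** When phi(1) = 0, the form at the point 1 with coefficient -phi(x) and the point x with
    coefficient 1 equals -2 |phi(x)|^2. *)
Lemma positive_definite_eq0 phi : positive_definite phi -> phi 1%g = 0 ->
  forall x, phi x = 0.
Proof.
move=> /positive_definiteP pphi p1 x.
have cj := psd_kernel_conj pphi.
have := pphi [:: (- phi x, 1%g); (1, x)].
rewrite /kernel_form !big_cons !big_nil /= mulVg p1 invg1 mul1g mulg1.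
have -> : phi x^-1%g = (phi x)^*%R.
  by have := cj x 1%g; rewrite mulg1 invg1 mul1g.
rewrite mulVg p1 rmorphN rmorph1 !mulr0 !addr0 add0r !mul1r !mulr1 mulNr.
rewrite mulNr (mulrC (phi x)^*%R) -opprD oppr_ge0 -normCK => h.
have n0 : 0 <= `|phi x| ^+ 2 by rewrite exprn_ge0.
have : `|phi x| ^+ 2 = 0.
  by apply/le_anti; rewrite n0 andbT; apply: le_trans h; rewrite lerDl.
by move/eqP; rewrite sqrf_eq0 normr_eq0 => /eqP.
Qed.

(* The Schur complement of phi(1) in the matrix of phi at 1 and the given
   points. *)
Lemma positive_definite_schur phi : positive_definite phi -> 0 < phi 1%g ->
  psd_kernel (fun x y => phi 1%g * phi (y^-1 * x)%g - phi x * (phi y)^*%R).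
Proof.
move=> /positive_definiteP pphi p0 s; set K := fun x y => phi (y^-1 * x)%g in pphi.
pose S := \sum_(p <- s) p.1 * phi p.2.
pose e : seq (R[i] * G) := [:: (1, 1%g)].
have se : kernel_form K s e = S.
  apply: eq_bigr => p _.
  by rewrite big_seq1 /= rmorph1 mulr1 /K invg1 mul1g.
have ee : kernel_form K e e = phi 1%g.
  by rewrite /kernel_form !big_seq1 /= rmorph1 !mul1r /K invg1 mul1g.
have p1 : (phi 1%g)^*%R = phi 1%g by apply/geC0_conj/ltW.
(* The form of [phi] at phi(1) s - S e is phi(1) times the required quantity, and phi(1) > 0 can be
   cancelled. *)
have := pphi (lscale (- S) e ++ lscale (phi 1%g) s).
rewrite kernel_formDl !kernel_formDr !kernel_formZl !kernel_formZr.
rewrite (kernel_form_conj pphi s e) se ee p1 rmorphN.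
have -> : - S * (- S^*%R * phi 1%g) + - S * (phi 1%g * S^*%R) +
    (phi 1%g * (- S^*%R * S) + phi 1%g * (phi 1%g * kernel_form K s s)) =
    phi 1%g * (phi 1%g * kernel_form K s s - S * S^*%R) by ring.
rewrite pmulr_rge0 //; congr (_ <= _).
rewrite /kernel_form rmorph_sum mulr_sumr mulr_suml -sumrB.
apply: eq_bigr => p _; rewrite mulr_sumr mulr_sumr -sumrB.
by apply: eq_bigr => q _; rewrite rmorphM /K; ring.
Qed.

Lemma Re_le (x y : R[i]) : x <= y -> Re x <= Re y.
Proof. by rewrite lecE => /andP[]. Qed.

(* If pi is a representation and v a vector, then phi * <pi(.) v, v> is again
   positive definite; this replaces the tensor product of pi with the
   representation attached to phi. *)
Lemma cstar_norm_mul phi a (C : R) : positive_definite phi ->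
  Re (phi 1%g) <= C -> 0 < C -> finitely_supported a -> (cstar_norm a <= 1)%E ->
  (cstar_norm (fun x => (C^-1)%:C * (a x * phi x))%R <= 1)%E.
Proof.
move=> pphi phiC C0 fa a1; apply/cstar_norm_le1 => H pi v v1.
have [r ur hr] := finitely_supported_seq fa.
set b := fun x => _.
have hb x : b x != 0 -> x \in r.
  by move=> bx; apply: hr; apply: contraNneq bx => a0; rewrite /b a0 mul0r mulr0.
pose g x y := inner H (pi x v) (pi y v).
have bE : inner H (rep_alg pi b v) (rep_alg pi b v) =
    (C^-1 * C^-1)%:C * kernel_form g [seq (a x * phi x, x) | x <- r]
                             [seq (a x * phi x, x) | x <- r].
  rewrite !(rep_algE _ _ ur hb) linear_sumlz /kernel_form big_map mulr_sumr.
  apply: eq_bigr => x _; rewrite linear_sumr big_map mulr_sumr.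
  apply: eq_bigr => y _; rewrite linearZl_LR linearZr_LR /= /b.
  by rewrite !rmorphM /= conj_realC; ring.
(* The Schur complement requires phi(1) > 0; otherwise [phi] vanishes identically. *)
have [p1|p1] := eqVneq (phi 1%g) 0.
  rewrite bE /kernel_form big_map big1 ?mulr0 //= => x _.
  by rewrite (positive_definite_eq0 pphi p1) big1 // => q _; rewrite mulr0 !mul0r.
have p0 : 0 < phi 1%g by rewrite lt_def p1 positive_definite_ge0.
pose psi := phi * (fun x => inner H (pi x v) v).
have psiE x : psi x = phi x * inner H (pi x v) v by [].
have ppsi : positive_definite psi.
  exact: positive_definiteM pphi (positive_definite_coef pi v).
(* The Schur complement of [phi] times the Gram kernel [g] is positive. Its first term gives the
   kernel of [psi], and its second the norm in [bE]. *)
have key : kernel_form g [seq (a x * phi x, x) | x <- r]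
      [seq (a x * phi x, x) | x <- r] <=
    phi 1%g * \sum_(x <- r) \sum_(y <- r) a x * (a y)^*%R * psi (y^-1 * x)%g.
  rewrite -subr_ge0; have := psd_kernelM (positive_definite_schur pphi p0)
    (psd_kernel_gram (fun x => pi x v)) [seq (a x, x) | x <- r].
  congr (_ <= _); rewrite /kernel_form !big_map mulr_sumr.
  rewrite -sumrB; apply: eq_bigr => x _; rewrite !big_map mulr_sumr -sumrB.
  apply: eq_bigr => y _ /=.
  have -> : psi (y^-1 * x)%g = phi (y^-1 * x)%g * g x y.
    by rewrite psiE /g -(urep_inner pi y (pi (y^-1 * x)%g v)) -urepM mulVKg.
  by rewrite rmorphM /g; ring.
(* The double sum is at most psi(1) = phi(1) <v, v> <= phi(1). With [key] this bounds the form of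
   [g] by phi(1)^2 <= C^2. *)
have := gns_bound ppsi ur hr a1.
have -> : psi 1%g = phi 1%g * inner H v v by rewrite psiE urep1.
move/Re_le: key; rewrite bE.
have /complex_ge0P[pr pi0] := ltW p0.
have /complex_ge0P[vr vi0] : 0 <= inner H v v := dnorm_ge0 _ _.
rewrite !Re_mul pi0 /=; set k := Re (kernel_form _ _ _); set S := Re (\sum_(x <- r) _).
move=> h1 h2; have h3 : k <= Re (phi 1%g) * S by lra.
have h4 : S <= Re (phi 1%g) by have := ler_wpM2l pr v1; lra.
suff : C^-1 * C^-1 * k <= 1 by lra.
rewrite -invfM mulrC ler_pdivrMr ?mulr_gt0 // mul1r.
apply: (le_trans h3); apply: (@le_trans _ _ (Re (phi 1%g) * Re (phi 1%g))).
  exact: ler_wpM2l.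
exact: ler_pM.
Qed.
End PositiveDefiniteFunctions.

(** * The norm of B(G) *)

Section FourierNorm.
Variables (R : realType) (G : groupType).
Implicit Types (phi psi a h u : G -> R[i]).

Lemma cmodE (z : R[i]) : (cmod z)%:C = `|z|.
Proof. by rewrite /cmod normc_def. Qed.

Lemma cmodD (x y : R[i]) : cmod (x + y) <= cmod x + cmod y.
Proof. by rewrite -lecR rmorphD /= !cmodE ler_normD. Qed.

Lemma cmodM (x y : R[i]) : cmod (x * y) = cmod x * cmod y.
Proof. by apply: complexI; rewrite rmorphM /= !cmodE normrM. Qed.

Lemma cmod0 : cmod (0 : R[i]) = 0.
Proof. by apply: complexI; rewrite cmodE normr0. Qed.

Lemma cmod_ge0 (x : R[i]) : 0 <= cmod x.
Proof. by rewrite -lecR cmodE normr_ge0. Qed.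

Lemma cmod_sqr (x : R[i]) : cmod x ^+ 2 = Re x ^+ 2 + Im x ^+ 2.
Proof. by apply: complexI; rewrite -normsqrc -cmodE rmorphXn. Qed.

Lemma cmod_real (r : R) : 0 <= r -> cmod r%:C = r.
Proof. by move=> r0; apply: complexI; rewrite cmodE ger0_norm ?ler0c. Qed.

Lemma cmod_sum (I : Type) (r : seq I) (F : I -> R[i]) :
  cmod (\sum_(i <- r) F i) <= \sum_(i <- r) cmod (F i).
Proof.
elim/big_ind2: _ => [|x X y Y hx hy|//]; first by rewrite cmod0.
by apply: le_trans (cmodD _ _) _; apply: lerD.
Qed.

(** This form lets norm estimates run on real bounds M and duplicate-free lists, away from
    arithmetic in [\bar R]. *)
Lemma fourier_normP u (M : R) : (fourier_norm u <= M%:E)%E <->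
  forall a r, uniq r -> (forall x, a x != 0 -> x \in r) ->
    (cstar_norm a <= 1)%E -> cmod (\sum_(x <- r) a x * u x) <= M.
Proof.
have sumE a r : uniq r -> (forall x, a x != 0 -> x \in r) ->
    \sum_(x \in [set: G]) a x * u x = \sum_(x <- r) a x * u x.
  move=> ur hr; apply: fsum_seq => // x ax; apply: hr.
  by apply: contraNneq ax => ->; rewrite mul0r.
split=> [uM a r ur hr a1|h].
  rewrite -lee_fin; apply: le_trans uM; apply: ereal_sup_ubound.
  exists a; split=> //; last by rewrite (sumE _ _ ur hr).
  by apply: sub_finite_set (finite_seq r) => x; apply: hr.
apply: ge_ereal_sup => _ [a [/finitely_supported_seq[r ur hr] a1 ->]].
by rewrite lee_fin (sumE _ _ ur hr) h.
Qed.

Lemma fourier_normD u v (M N : R) : (fourier_norm u <= M%:E)%E ->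
  (fourier_norm v <= N%:E)%E -> (fourier_norm (u + v)%R <= (M + N)%:E)%E.
Proof.
move=> /fourier_normP hu /fourier_normP hv; apply/fourier_normP => a r ur hr a1.
under eq_bigr do rewrite mulrDr.
rewrite big_split /=; apply: le_trans (cmodD _ _) _.
by apply: lerD; [apply: hu | apply: hv].
Qed.

Lemma fourier_normZ c u (M : R) : (fourier_norm u <= M%:E)%E ->
  (fourier_norm (c *: u)%R <= (cmod c * M)%:E)%E.
Proof.
move=> /fourier_normP hu; apply/fourier_normP => a r ur hr a1.
under eq_bigr => x _ do rewrite (mulrCA (a x) c (u x)).
by rewrite -mulr_sumr cmodM ler_wpM2l ?cmod_ge0 // hu.
Qed.

Lemma fourier_norm0 : (fourier_norm (0%R : G -> R[i]) <= 0%:E)%E.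
Proof.
apply/fourier_normP => a r ur hr a1; rewrite big1 ?cmod0 // => x _.
exact: mulr0.
Qed.

(** The functional is tested on the point mass at x, which acts unitarily in every
    representation. *)
Lemma cmod_le_fourier_norm u x (M : R) :
  (fourier_norm u <= M%:E)%E -> cmod (u x) <= M.
Proof.
move=> /fourier_normP /(_ (fun y => (y == x)%:R) [:: x] isT).
rewrite big_seq1 eqxx mul1r; apply=> [y|].
  by rewrite inE; case: (y == x) => //; rewrite eqxx.
apply/cstar_norm_le1 => H pi v v1; rewrite (@rep_algE _ _ _ _ _ _ [:: x]) //.
  by rewrite big_seq1 eqxx scale1r urep_inner.
by move=> y; rewrite inE; case: (y == x) => //; rewrite eqxx.
Qed.

(** The GNS bound for the indicator of 1, that is, for the regular representation, says \sum
    |a(y)|^2 <= 1. *)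
Lemma cstar_norm_cmod a r x : uniq r -> (forall x, a x != 0 -> x \in r) ->
  (cstar_norm a <= 1)%E -> cmod (a x) <= 1.
Proof.
move=> ur hr a1; have [ax|/hr xr] := eqVneq (a x) 0; first by rewrite ax cmod0.
have := gns_bound (@positive_definite_eq1 R G) ur hr a1; rewrite eqxx /=.
rewrite [X in Re X](_ : _ = \sum_(y <- r) `|a y| ^+ 2); last first.
  apply: eq_big_seq => y yr; rewrite (bigD1_seq y) //= big1 => [|z zy].
    by rewrite mulVg eqxx mulr1 addr0 normCK.
  rewrite (_ : (z^-1 * y == 1)%g = false) ?mulr0 //; apply/negP => /eqP e.
  by case/negP: zy; rewrite -[y](mulVKg z) e mulg1.
rewrite (bigD1_seq x) //= => h.
have s0 : 0 <= \sum_(i <- r | i != x) `|a i| ^+ 2.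
  by apply: sumr_ge0 => i _; rewrite exprn_ge0.
have /complex_ge0P[s1 _] := s0.
rewrite -(@expr_le1 _ 2) ?cmod_ge0 //; apply: le_trans h.
by rewrite ReD normsqrc cmod_sqr lerDl.
Qed.

Lemma fourier_norm_l1 h (M : R) :
  (forall r, uniq r -> \sum_(x <- r) cmod (h x) <= M) ->
  (fourier_norm h <= M%:E)%E.
Proof.
move=> hM; apply/fourier_normP => a r ur hr a1.
apply: le_trans (cmod_sum _ _) _; apply: le_trans (hM _ ur).
apply: ler_sum => x _; rewrite cmodM ler_piMl ?cmod_ge0 //.
exact: cstar_norm_cmod ur hr a1.
Qed.

(** Dual to [cstar_norm_mul]: pairing phi u with a is pairing u with a phi. Using phi(1) + 1 instead
    of phi(1) allows division when phi(1) = 0. *)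
Lemma fourier_norm_pdM phi u (M : R) : positive_definite phi ->
  (fourier_norm u <= M%:E)%E ->
  (fourier_norm (phi * u)%R <= ((Re (phi 1%g) + 1) * M)%:E)%E.
Proof.
move=> pphi /fourier_normP hu; apply/fourier_normP => a r ur hr a1.
have /complex_ge0P[p0 _] := positive_definite_ge0 pphi.
set C := Re (phi 1%g) + 1; have C0 : 0 < C by rewrite /C; lra.
have fa : finitely_supported a.
  by apply: sub_finite_set (finite_seq r) => x; apply: hr.
have := cstar_norm_mul pphi (_ : _ <= C) C0 fa a1; rewrite /C lerDl ler01 -/C.
move=> /(_ isT)/(hu _ r ur) h.
rewrite -ler_pdivrMl // -(@cmod_real C^-1) ?invr_ge0 ?(ltW C0) //.
rewrite -cmodM mulr_sumr; apply: le_trans (h _); last first.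
  move=> x n0; apply: hr; apply: contraNneq n0 => ->.
  by rewrite mul0r mulr0.
by under [X in _ <= cmod X]eq_bigr do rewrite -!mulrA.
Qed.

End FourierNorm.

(** * B(G) as an algebra of bounded multipliers *)

Section FourierStieltjes.
Variables (R : realType) (G : groupType).
Implicit Types (phi psi a h u f g : G -> R[i]).

Lemma fourier_stieltjes_pd phi : positive_definite phi -> fourier_stieltjes phi.
Proof.
by move=> p; exists 1, (fun=> 1), (fun=> phi); rewrite big_ord1 scale1r.
Qed.

Lemma fourier_stieltjes0 : fourier_stieltjes (0 : G -> R[i]).
Proof. by exists 0, (fun=> 0), (fun=> 0); rewrite big_ord0; split=> // -[]. Qed.

Lemma fourier_stieltjesZ c f : fourier_stieltjes f -> fourier_stieltjes (c *: f).
Proof.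
move=> [n [d [phi [pphi ->]]]]; exists n, (fun i => c * d i), phi; split=> //.
by rewrite scaler_sumr; apply: eq_bigr => i _; rewrite scalerA.
Qed.

Lemma fourier_stieltjesD f g :
  fourier_stieltjes f -> fourier_stieltjes g -> fourier_stieltjes (f + g).
Proof.
move=> [n [c [phi [pphi ->]]]] [m [d [psi [ppsi ->]]]].
exists (n + m)%N, (fun i => match fintype.split i with inl j => c j | inr j => d j end),
  (fun i => match fintype.split i with inl j => phi j | inr j => psi j end).
split=> [i|]; first by case: (fintype.split i).
rewrite big_split_ord; congr (_ + _); apply: eq_bigr => i _ /=.
  by rewrite (unsplitK (inl i)).
by rewrite (unsplitK (inr i)).
Qed.

Lemma fourier_stieltjes_ind (P : (G -> R[i]) -> Prop) :
  P 0 -> (forall f g, P f -> P g -> P (f + g)) ->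
  (forall c f, P f -> P (c *: f)) ->
  (forall phi, positive_definite phi -> P phi) ->
  forall f, fourier_stieltjes f -> P f.
Proof.
move=> P0 PD PZ Ppd _ [n [c [phi [pphi ->]]]].
by apply: (big_ind P) => // i _; apply/PZ/Ppd.
Qed.

Lemma fct_scaleAl (c : R[i]) f g : (c *: f) * g = c *: (f * g).
Proof. by apply/funext => x; apply/esym/mulrA. Qed.

Lemma fourier_stieltjesM f g :
  fourier_stieltjes f -> fourier_stieltjes g -> fourier_stieltjes (f * g).
Proof.
move=> fs_f; move: g; elim/fourier_stieltjes_ind: fs_f
  => [g _|f1 f2 h1 h2 g gs|c f1 h1 g gs|phi pphi].
- by rewrite mul0r; apply: fourier_stieltjes0.
- by rewrite mulrDl; apply: fourier_stieltjesD; [apply: h1 | apply: h2].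
- by rewrite fct_scaleAl; apply/fourier_stieltjesZ/h1.
apply: fourier_stieltjes_ind => [|f1 f2 h1 h2|c f1 h1|psi ppsi].
- by rewrite mulr0; apply: fourier_stieltjes0.
- by rewrite mulrDr; apply: fourier_stieltjesD.
- by rewrite mulrC fct_scaleAl mulrC; apply: fourier_stieltjesZ.
exact/fourier_stieltjes_pd/positive_definiteM.
Qed.

Lemma fourier_norm_multiplier f : fourier_stieltjes f ->
  exists2 C : R, 0 < C & forall u (M : R), (fourier_norm u <= M%:E)%E ->
    (fourier_norm (f * u)%R <= (C * M)%:E)%E.
Proof.
have nneg u (M : R) : (fourier_norm u <= M%:E)%E -> 0 <= M.
  by move=> /(cmod_le_fourier_norm 1%g); apply: le_trans; apply: cmod_ge0.
elim/fourier_stieltjes_ind => [|f1 f2 [C1 p1 h1] [C2 p2 h2]|c f1 [C p h]|phi pphi].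
- exists 1 => // u M hu; rewrite mul0r; apply: le_trans (fourier_norm0 _ _) _.
  by rewrite lee_fin mul1r (nneg u).
- exists (C1 + C2) => [|u M hu]; first exact: addr_gt0.
  by rewrite !mulrDl; apply: fourier_normD; [apply: h1 | apply: h2].
(* The summand 1 keeps the constant positive when c = 0. *)
- exists ((cmod c + 1) * C) => [|u M hu].
    by rewrite mulr_gt0 // ltr_wpDl ?cmod_ge0.
  rewrite fct_scaleAl; apply: le_trans (fourier_normZ c (h _ _ hu)) _.
  rewrite lee_fin -mulrA ler_wpM2r ?lerDl ?ler01 //.
  by rewrite mulr_ge0 ?(ltW p) // (nneg u).
exists (Re (phi 1%g) + 1) => [|u M hu]; last exact: fourier_norm_pdM.
by have /complex_ge0P[p0 _] := positive_definite_ge0 pphi; lra.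
Qed.

End FourierStieltjes.

(** * Summable functions *)

Section L1Functions.
Variables (R : realType) (G : groupType).
Implicit Types (phi h : G -> R[i]).

Lemma kernel_formK_D (X : Type) (K L : X -> X -> R[i]) s :
  kernel_form (fun x y => K x y + L x y) s s =
  kernel_form K s s + kernel_form L s s.
Proof.
rewrite /kernel_form -big_split; apply: eq_bigr => p _; rewrite -big_split.
by apply: eq_bigr => q _; rewrite mulrDr.
Qed.

Lemma kernel_formK_Z (X : Type) c (K : X -> X -> R[i]) s :
  kernel_form (fun x y => c * K x y) s s = c * kernel_form K s s.
Proof.
rewrite /kernel_form mulr_sumr; apply: eq_bigr => p _; rewrite mulr_sumr.
by apply: eq_bigr => q _; rewrite mulrCA.
Qed.

Lemma kernel_formK_sum (X I : Type) (r : seq I) (K : I -> X -> X -> R[i]) s :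
  kernel_form (fun x y => \sum_(i <- r) K i x y) s s =
  \sum_(i <- r) kernel_form (K i) s s.
Proof.
rewrite /kernel_form [RHS]exchange_big /=; apply: eq_bigr => p _.
rewrite [RHS]exchange_big /=; apply: eq_bigr => q _.
by rewrite mulr_sumr.
Qed.

(* This is |w| <lambda(x) xi, lambda(y) xi> for the regular representation
   lambda and xi = (w / |w|) delta_1 + delta_z. *)
Lemma psd_kernel_two_points (w : R[i]) (z : G) :
  psd_kernel (fun x y : G => 2 * `|w| * (y^-1 * x == 1)%g%:R
    + w * (y^-1 * x == z)%g%:R + w^*%R * (x^-1 * y == z)%g%:R).
Proof.
have [->|w0] := eqVneq w 0.
  move=> s; rewrite /kernel_form big1 // => p _; rewrite big1 // => q _.
  by rewrite normr0 rmorph0; ring.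
move=> s; pose t := w / `|w|.
have nw : `|w| != 0 by rewrite normr_eq0.
have tt : t * t^*%R = 1.
  by rewrite -normCK normrM normfV normr_id divff // expr1n.
have wt : w = `|w| * t by rewrite mulrC divfK.
have wt' : w^*%R = `|w| * t^*%R by rewrite {1}wt rmorphM /= conj_normC.
pose D (x y : G) : R[i] := (x == y)%:R.
(* This encodes \sum p.1 lambda(p.2) xi: the point p.2 receives t p.1, and p.2 z receives p.1. *)
pose s' := lscale t s ++ [seq (p.1, p.2 * z)%g | p <- s].
have : 0 <= `|w| * kernel_form D s' s'.
  by rewrite mulr_ge0 //; apply: psd_kernel_eq.
congr (_ <= _).
rewrite kernel_formDl !kernel_formDr !kernel_formZl !kernel_formZr mulrA tt mul1r.
rewrite /kernel_form !big_map !mulr_sumr -!big_split mulr_sumr /=.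
apply: eq_bigr => p _; rewrite !big_map !mulr_sumr -!big_split mulr_sumr /=.
apply: eq_bigr => q _; rewrite /D.
have e1 : (q.2^-1 * p.2 == 1)%g = (p.2 == q.2).
  by apply/eqP/eqP => [e|->]; rewrite ?mulVg // -[RHS]mulg1 -e mulVKg.
have e2 : (q.2^-1 * p.2 == z)%g = (p.2 == q.2 * z)%g.
  by apply/eqP/eqP => [<-|->]; rewrite ?mulVKg ?mulKg.
have e3 : (p.2^-1 * q.2 == z)%g = (p.2 * z == q.2)%g.
  by apply/eqP/eqP => [<-|<-]; rewrite ?mulVKg ?mulKg.
have e4 : (p.2 * z == q.2 * z)%g = (p.2 == q.2).
  by apply/eqP/eqP => [/mulIg|->].
rewrite e1 e2 e3 e4 wt'; move: (`|w|) wt => n ->; ring.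
Qed.

(** The function is a sum of two-point functions with weights c h(z), one for each z, plus a
    nonnegative multiple of the indicator of 1. *)
Lemma positive_definite_l1 h (M : R) (c : R[i]) :
  (forall r, uniq r -> \sum_(x <- r) cmod (h x) <= M) -> `|c| = 1 ->
  positive_definite (fun y => 2 * M%:C * (y == 1%g)%:R + c * h y
                              + c^*%R * (h y^-1%g)^*%R).
Proof.
move=> hM c1; apply/positive_definiteP => s.
(* Only finitely many quotients y^-1 x occur for the given s, so z may be restricted to them; [rest]
   is the part of M that they leave over. *)
pose Z := undup [seq (y.2^-1 * x.2)%g | x <- s, y <- s].
pose rest := (M - \sum_(z <- Z) cmod (h z))%:C.
have rest0 : 0 <= rest by rewrite ler0c subr_ge0 hM ?undup_uniq.
have : 0 <= kernel_form (fun x y => 2 * rest * (x == y)%:R + \sum_(z <- Z)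
    (2 * `|c * h z| * (y^-1 * x == 1)%g%:R + c * h z * (y^-1 * x == z)%g%:R
     + (c * h z)^*%R * (x^-1 * y == z)%g%:R)) s s.
  rewrite kernel_formK_D kernel_formK_sum kernel_formK_Z addr_ge0 //.
    by rewrite !mulr_ge0 //; apply: psd_kernel_eq.
  by apply: sumr_ge0 => z _; apply: psd_kernel_two_points.
congr (_ <= _); apply: eq_big_seq => p ps; apply: eq_big_seq => q qs.
congr (_ * _).
have e1 : (q.2^-1 * p.2 == 1)%g = (p.2 == q.2).
  by apply/eqP/eqP => [e|->]; rewrite ?mulVg // -[RHS]mulg1 -e mulVKg.
have pick (F : G -> R[i]) y : y \in Z -> \sum_(z <- Z) F z * (y == z)%:R = F y.
  move=> yZ; rewrite (bigD1_seq y) ?undup_uniq //= eqxx mulr1 big1 ?addr0 //.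
  by move=> z zy; rewrite eq_sym (negbTE zy) mulr0.
have m1 : (q.2^-1 * p.2)%g \in Z by rewrite mem_undup; apply/allpairsP; exists (p, q).
have m2 : (p.2^-1 * q.2)%g \in Z by rewrite mem_undup; apply/allpairsP; exists (q, p).
rewrite !big_split /= pick // pick // invgM invgK rmorphM e1.
rewrite -mulr_suml -mulr_sumr.
under eq_bigr do rewrite normrM c1 mul1r -cmodE.
by rewrite /rest rmorphB rmorph_sum /=; ring.
Qed.

Lemma fourier_stieltjes_l1 h (M : R) :
  (forall r, uniq r -> \sum_(x <- r) cmod (h x) <= M) -> fourier_stieltjes h.
Proof.
move=> hM; pose j : R[i] := 'i%R.
pose P (c : R[i]) y := 2 * M%:C * (y == 1%g)%:R + c * h y
                              + c^*%R * (h y^-1%g)^*%R.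
have fsP c : `|c| = 1 -> fourier_stieltjes (P c).
  by move=> c1; apply/fourier_stieltjes_pd/positive_definite_l1.
(* Write k(y) for the conjugate of h(y^-1). Then P(c) - P(-c) = 2 (c h + conj(c) k), and c = 1, 'i
   give h + k and h - k up to scalars. *)
have -> : h = (4^-1 *: (P 1 + (-1) *: P (-1))) +
    ((4 * j)^-1 *: (P j + (-1) *: P (- j))).
  apply/funext => y.
  have -> : (4^-1 *: (P 1 + (-1) *: P (-1)) +
    (4 * j)^-1 *: (P j + (-1) *: P (- j))) y =
    4^-1 * (P 1 y + (-1) * P (-1) y) +
    (4 * j)^-1 * (P j y + (-1) * P (- j) y) by [].
  rewrite /P !rmorphN !rmorph1 /= conjCi -/j; set X := (h y^-1%g)^*%R.
  field; exact: neq0Ci.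
have i1 : `|j : R[i]| = 1 by rewrite normCi.
apply: fourier_stieltjesD; apply: fourier_stieltjesZ; apply: fourier_stieltjesD;
  try apply: fourier_stieltjesZ; apply: fsP; rewrite ?normrN ?normr1 //.
Qed.

End L1Functions.

(** * Closed ideals of the Fourier algebra *)

Section FourierAlgebra.
Variables (R : realType) (G : groupType).
Implicit Types (f g h u v : G -> R[i]).
Local Notation A := (@fourier_algebra R G).
Local Notation N := (@fourier_norm R G).

Lemma ler_sum_uniq_sub (T : eqType) (r s : seq T) (F : T -> R) :
  (forall x, 0 <= F x) -> uniq r -> uniq s -> {subset r <= s} ->
  \sum_(x <- r) F x <= \sum_(x <- s) F x.
Proof.
move=> F0 ur us rs; rewrite [leRHS](bigID (mem r)) /= -[leRHS]/(_ + _).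
rewrite -[X in _ <= X + _]big_filter (_ : \sum_(x <- r) F x =
    \sum_(x <- [seq x <- s | x \in r]) F x).
  by rewrite lerDl sumr_ge0.
apply: perm_big; apply: uniq_perm => //; first exact: filter_uniq.
by move=> x; rewrite mem_filter; case: (boolP (x \in r)) => // /rs ->.
Qed.

Lemma fourier_stieltjes_finite h : finitely_supported h -> fourier_stieltjes h.
Proof.
move=> /finitely_supported_seq[s us hs].
apply: (@fourier_stieltjes_l1 _ _ _ (\sum_(x <- s) cmod (h x))) => r ur.
rewrite (bigID (mem s)) /= addrC big1 => [|x xs].
  rewrite add0r -big_filter; apply: ler_sum_uniq_sub => [x|||x].
  - exact: cmod_ge0.
  - exact: filter_uniq.
  - exact: us.
  - by rewrite mem_filter => /andP[].
have [->|/hs] := eqVneq (h x) 0; first exact: cmod0.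
by rewrite (negbTE xs).
Qed.

Lemma fourier_algebraP f : A f <-> fourier_stieltjes f /\
  forall e : R, 0 < e -> exists2 v, finitely_supported v & (N (f - v)%R <= e%:E)%E.
Proof.
split=> -[fs_f hf]; split=> // e e0.
  by have [v [_ fv /ltW h]] := hf _ e0; exists v.
have [|v fv h] := hf (e / 2); first by rewrite divr_gt0.
exists v; split=> //; first exact: fourier_stieltjes_finite.
by apply: le_lt_trans h _; rewrite lte_fin; lra.
Qed.

Lemma fourier_closureP (S : set (G -> R[i])) f : norm_closure A N S f <->
  A f /\ forall e : R, 0 < e -> exists2 g, S g & (N (f - g)%R <= e%:E)%E.
Proof.
split=> -[Af hf]; split=> // e e0.
  by have [v [Sv /ltW h]] := hf _ e0; exists v.
have [|v Sv h] := hf (e / 2); first by rewrite divr_gt0.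
by exists v; split=> //; apply: le_lt_trans h _; rewrite lte_fin; lra.
Qed.

Lemma fourier_algebra_finite h : finitely_supported h -> A h.
Proof.
move=> fh; apply/fourier_algebraP; split=> [|e e0].
  exact: fourier_stieltjes_finite.
exists h => //; rewrite subrr; apply: le_trans (fourier_norm0 _ _) _.
by rewrite lee_fin ltW.
Qed.

Lemma finitely_supported_sub f g : (forall x, f x = 0 -> g x = 0) ->
  finitely_supported f -> finitely_supported g.
Proof. by move=> h; apply: sub_finite_set => x /=; apply: contra_neq; apply: h. Qed.

Lemma finitely_supportedP c f g : finitely_supported f ->
  finitely_supported g -> finitely_supported (c *: f + g).
Proof.
move=> ff fg; have := conj ff fg; rewrite -finite_setU; apply: sub_finite_set.
move=> x /=; have [fx|] := eqVneq (f x) 0; last by left.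
have [gx|] := eqVneq (g x) 0; last by right.
by rewrite (_ : (c *: f + g) x = c * f x + g x) // fx gx mulr0 addr0 eqxx.
Qed.

Lemma fourier_algebraL c f g : A f -> A g -> A (c *: f + g).
Proof.
move=> /fourier_algebraP[sf hf] /fourier_algebraP[sg hg]; apply/fourier_algebraP.
split=> [|e e0].
  by apply: fourier_stieltjesD => //; apply: fourier_stieltjesZ.
have c0 : 0 < cmod c + 1 by rewrite ltr_wpDl ?cmod_ge0.
have [|v fv hv] := hf (e / 2 / (cmod c + 1)); first by rewrite !divr_gt0.
have [|w fw hw] := hg (e / 2); first by rewrite !divr_gt0.
exists (c *: v + w); first exact: finitely_supportedP.
have -> : c *: f + g - (c *: v + w) = c *: (f - v) + (g - w).
  by rewrite scalerBr opprD addrACA.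
apply: le_trans (fourier_normD (fourier_normZ c hv) hw) _.
rewrite lee_fin -lerBrDr (_ : e - e / 2 = e / 2); last by lra.
rewrite mulrCA ler_piMr ?divr_ge0 ?(ltW e0) //.
by rewrite ler_pdivrMr // mul1r lerDl.
Qed.

(** If v of finite support approximates f, then v g has finite support and approximates f g, because
    multiplication by g is bounded. *)
Lemma fourier_algebraM f g : A f -> A g -> A (f * g).
Proof.
move=> /fourier_algebraP[sf hf] /fourier_algebraP[sg hg]; apply/fourier_algebraP.
split=> [|e e0]; first exact: fourier_stieltjesM.
have [C C0 hC] := fourier_norm_multiplier sg.
have [|v fv hv] := hf (e / C); first by rewrite divr_gt0.
exists (v * g).
  apply: finitely_supported_sub fv => x vx.
  by rewrite (_ : (v * g) x = v x * g x) // vx mul0r.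
rewrite -mulrBl mulrC; apply: le_trans (hC _ _ hv) _.
by rewrite lee_fin mulrC divfK ?gt_eqF.
Qed.

(** The norm dominates the supremum norm, so a point where |f| > 1/(k+1) lies in the finite support
    of the k-th approximant. *)
Lemma fourier_algebra_countable_support f : A f -> countable [set x | f x != 0].
Proof.
move=> /fourier_algebraP[_ hf].
have /choice[v hv] (k : nat) : exists v, finitely_supported v /\
    (N (f - v)%R <= (k.+1%:R^-1)%:E)%E.
  by have [|v fv h] := hf k.+1%:R^-1; [rewrite invr_gt0 ltr0Sn | exists v].
apply: (@sub_countable _ _ _ (\bigcup_(k in [set: nat]) [set x | v k x != 0])).
  apply: subset_card_le => x /= fx.
  have c0 : 0 < cmod (f x) by rewrite -ltcR cmodE normr_gt0.
  pose k := Num.bound (cmod (f x))^-1; exists k => //=.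
  have [_ /(cmod_le_fourier_norm x) h] := hv k.
  apply: contraTneq h => vx; rewrite (_ : (f - v k) x = f x - v k x) // vx subr0.
  rewrite -ltNge invf_plt ?posrE ?ltr0Sn //.
  apply: lt_trans (archi_boundP _) _; first by rewrite invr_ge0 ltW.
  by rewrite ltr_nat.
by apply: bigcup_countable => // k _; apply: finite_set_countable; apply (hv k).1.
Qed.

Definition delta (x : G) : G -> R[i] := fun y => (y == x)%:R.

Lemma finitely_supported_delta x : finitely_supported (delta x).
Proof.
apply: (@sub_finite_set _ _ [set x]); last exact: finite_set1.
by move=> y /=; rewrite /delta; case: (y =P x) => // _; rewrite eqxx.
Qed.

Lemma noetherian_countable : topologically_noetherian A N -> countable [set: G].
Proof.
move=> /(_ A)[|n [x [Ax AE]]].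
  split=> //.
  - apply: fourier_algebra_finite.
    apply: (@sub_finite_set _ _ set0); last exact: finite_set0.
    by move=> x; rewrite /= eqxx.
  - exact: fourier_algebraL.
  - exact: fourier_algebraM.
  - by move=> f [].
apply: (@sub_countable _ _ _ (\bigcup_(i in [set: 'I_n]) [set y | x i y != 0])).
  apply: subset_card_le => y _.
  have := fourier_algebra_finite (finitely_supported_delta y).
  (* Any combination of the [x i] vanishes at y when all of them do, and then differs from [delta y]
     by 1 there. The tolerance 1/2 excludes this. *)
  rewrite AE => /fourier_closureP[_ /(_ 2^-1)[]]; first by rewrite invr_gt0.
  move=> _ [b [_ ->]] /(cmod_le_fourier_norm y) h; apply: contrapT => ny.
  move: h; set g := (X in delta y - X).
  have gy : g y = 0.
    rewrite /g fct_sumE big1 // => i _; rewrite (_ : (b i * x i) y = b i y * x i y) //.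
    have [->|xy] := eqVneq (x i y) 0; first by rewrite mulr0.
    by case: ny; exists i.
  rewrite (_ : (delta y - g) y = delta y y - g y) // gy subr0 /delta eqxx.
  by rewrite (_ : 1%:R = (1 : R)%:C) // cmod_real //; lra.
apply: bigcup_countable => [|i _]; first exact: countableP.
exact: fourier_algebra_countable_support.
Qed.

Lemma sum_half_powers (m : nat) (s : seq nat) : uniq s -> all (leq m) s ->
  \sum_(k <- s) (2^-1 : R) ^+ k <= 2 * 2^-1 ^+ m.
Proof.
move=> us /allP ms; pose b := (\max_(k <- s) k).+1.
have geo j : \sum_(k <- iota m j) (2^-1 : R) ^+ k <= 2 * 2^-1 ^+ m - 2^-1 ^+ (m + j) * 2.
  elim: j => [|j IH]; first by rewrite big_nil addn0; lra.
  rewrite -addn1 iotaD big_cat /= big_seq1 addn1 addnS exprS.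
  apply: le_trans (lerD IH (lexx _)) _; lra.
apply: (@le_trans _ _ (\sum_(k <- iota m b) (2^-1 : R) ^+ k)).
  apply: ler_sum_uniq_sub (iota_uniq _ _) _ => // k ks.
  rewrite mem_iota (ms _ ks) /= ltn_addl // ltnS.
  by apply: (@leq_bigmax_seq _ _ xpredT id).
by apply: le_trans (geo b) _; rewrite lerBlDr lerDl mulr_ge0 // exprn_ge0.
Qed.

Lemma half_power_small (e : R) : 0 < e -> exists m : nat, 2 * (2^-1 : R) ^+ m <= e.
Proof.
move=> e0; pose m := Num.bound (2 / e); exists m.
have := archi_boundP (divr_ge0 (ler0n R 2) (ltW e0)); rewrite -/m => h.
have : (m%:R : R) <= 2 ^+ m by rewrite -natrX ler_nat ltnW // ltn_expl.
rewrite exprVn ler_pdivrMr ?exprn_gt0 // -ler_pdivrMl // mulrC => h2.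
by apply: le_trans h2; apply: ltW.
Qed.

(** * A single generator for a closed ideal *)

Section ClosedIdeal.
Variables (I : set (G -> R[i])) (idI : closed_ideal A N I).

Let supp : set G := [set y | exists2 f, I f & f y != 0].

Let subA : I `<=` A. Proof. by case: idI. Qed.
Let I0 : I 0. Proof. by case: idI. Qed.
Let IL c f g : I f -> I g -> I (c *: f + g). Proof. by case: idI => _ _ + _ _; apply. Qed.
Let IM a f : A a -> I f -> I (a * f). Proof. by case: idI => _ _ _ + _; apply. Qed.
Let Icl : norm_closure A N I `<=` I. Proof. by case: idI. Qed.

(** If f in [I] has f(x) != 0, then [delta x] is (f x)^-1 times [delta x * f], hence lies in [I]. *)
Lemma closed_ideal_finite h : finitely_supported h ->
  (forall x, h x != 0 -> supp x) -> I h.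
Proof.
move=> /finitely_supported_seq[r ur hr] hs.
have -> : h = \sum_(x <- r) h x *: delta x.
  apply/funext => y; rewrite fct_sumE.
  have [yr|yr] := boolP (y \in r).
    rewrite (bigD1_seq y) //= big1 => [|z zy].
      by rewrite addr0 (_ : (h y *: delta y) y = h y * (y == y)%:R) // eqxx mulr1.
    rewrite (_ : (h z *: delta z) y = h z * (y == z)%:R) //.
    by rewrite eq_sym (negbTE zy) mulr0.
  rewrite big_seq big1 => [|z zr]; first by apply/eqP; apply: contraNT yr; apply: hr.
  rewrite (_ : (h z *: delta z) y = h z * (y == z)%:R) //.
  by case: (y =P z) => [yz|_]; [rewrite yz zr in yr | rewrite mulr0].
elim: r {ur hr} => [|x r IH]; first by rewrite big_nil.
rewrite big_cons; have [hx|/hs[f If fx]] := eqVneq (h x) 0.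
  by rewrite hx scale0r add0r.
apply: IL => //.
have -> : delta x = (f x)^-1 *: (delta x * f) + 0.
  apply/funext => y; rewrite addr0.
  rewrite (_ : ((f x)^-1 *: (delta x * f)) y = (f x)^-1 * (delta x y * f y)) //.
  rewrite /delta; case: (y =P x) => [->|_]; last by rewrite mul0r mulr0.
  by rewrite mul1r mulVf.
apply: IL => //; apply: IM => //.
exact/fourier_algebra_finite/finitely_supported_delta.
Qed.

Variable num : G -> nat.
Hypothesis num_inj : injective num.

(** Injectivity of [num] makes these weights summable, with total at most 2; they are positive
    exactly on [supp]. *)
Let w (y : G) : R := if `[< supp y >] then 2^-1 ^+ num y else 0.

Let gen (y : G) : R[i] := (w y)%:C.

Let w_le y : 0 <= w y <= 2^-1 ^+ num y.
Proof.
have h : 0 <= (2^-1 : R) ^+ num y by rewrite exprn_ge0 ?invr_ge0.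
by rewrite /w; case: asboolP => _; rewrite ?lexx ?h.
Qed.

Let gen_eq0 y : (gen y == 0) = ~~ `[< supp y >].
Proof.
rewrite /gen /w; case: asboolP => _; last by rewrite eqxx.
by apply/negbTE; rewrite fmorph_eq0 expf_eq0 invr_eq0 pnatr_eq0 andbF.
Qed.

Let tail_sum m r : uniq r ->
  \sum_(x <- r) cmod (if (num x < m)%N then 0 else gen x) <= 2 * 2^-1 ^+ m.
Proof.
move=> ur; rewrite (bigID (fun x => num x < m)%N) /= big1 => [|x xm]; last first.
  by rewrite xm cmod0.
rewrite add0r; apply: le_trans (sum_half_powers (m := m)
    (s := [seq num x | x <- [seq x <- r | ~~ (num x < m)%N]]) _ _).
- rewrite big_map big_filter; apply: ler_sum => x /negbTE ->.
  by have /andP[w0 w1] := w_le x; rewrite cmod_real.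
- by rewrite map_inj_uniq ?filter_uniq.
by apply/allP => k /mapP[x + ->]; rewrite mem_filter -leqNgt => /andP[].
Qed.

Let gen_trunc m : I (fun x => if (num x < m)%N then gen x else 0).
Proof.
apply: closed_ideal_finite => [|x]; last first.
  by case: ifP; rewrite ?eqxx // gen_eq0 negbK => _ /asboolP.
apply: (@sub_finite_set _ _ (num @^-1` `I_m)) => [x /=|].
  by case: ifP; rewrite ?eqxx.
by apply: finite_preimage => // x y _ _; apply: num_inj.
Qed.

Let gen_approx (e : R) : 0 < e -> exists m : nat,
  (N (gen - (fun x => if (num x < m)%N then gen x else 0%R))%R <= e%:E)%E.
Proof.
move=> /half_power_small[m hm]; exists m; apply: fourier_norm_l1 => r ur.
apply: le_trans hm; apply: le_trans (tail_sum m ur).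
apply: ler_sum => x _.
set t := fun x => _; rewrite (_ : (gen - t) x = gen x - t x) // /t.
by case: ifP => _; rewrite ?subrr ?subr0.
Qed.

(** The truncations of [gen] lie in [I] and converge to it in l^1 norm, hence in the norm of B(G).
    They also show that [gen] lies in A(G), as the closure requires. *)
Let gen_in : I gen.
Proof.
apply: Icl; apply/fourier_closureP; split; last first.
  by move=> e /gen_approx[m hm]; eexists; [exact: (gen_trunc m) | exact: hm].
apply/fourier_algebraP; split=> [|e /gen_approx[m hm]].
  apply: (@fourier_stieltjes_l1 _ _ _ (2 * 2^-1 ^+ 0)) => r ur.
  (* At m = 0 nothing is cut off, so the tail is the whole sum. *)
  by apply: le_trans (tail_sum 0 ur).
eexists; last exact: hm.
apply: (@sub_finite_set _ _ (num @^-1` `I_m)) => [x /=|].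
  by case: ifP; rewrite ?eqxx.
by apply: finite_preimage => // x y _ _; apply: num_inj.
Qed.

Lemma closed_ideal_singly_generated :
  (forall f, A f -> norm_closure A N [set u * f | u in A] f) ->
  exists2 g, I g & I = norm_closure A N [set b * g | b in unitisation A].
Proof.
move=> hG; exists gen => //; apply/seteqP; split=> f; last first.
  move=> /fourier_closureP[Af hf]; apply: Icl; apply/fourier_closureP.
  split=> // e /hf[_ [b Ab <-] h]; exists (b * gen) => //.
  case: Ab => [Ab|[_ [a [c [Aa ->]]]]]; first exact: IM.
  (* An adjoined constant acts as a scalar, and [I] is a linear subspace. *)
  rewrite mulrDl addrC (_ : cst c * gen = c *: gen) //.
  by apply: IL => //; apply: IM.
move=> If; apply/fourier_closureP; split=> [|e e0]; first exact: subA.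
have /fourier_algebraP[fs_f _] := subA If.
have [C C0 hC] := fourier_norm_multiplier fs_f.
(* The hypothesis gives u f near f; u is then replaced by v of finite support, at a cost controlled
   by the multiplier constant of f. *)
have /fourier_closureP[_ /(_ (e / 2))[]] := hG f (subA If); first by rewrite divr_gt0.
move=> _ [u /fourier_algebraP[_ hu] <-] huf.
have [|v fv hv] := hu (e / 2 / C); first by rewrite !divr_gt0.
exists (v * f); last first.
  have -> : f - v * f = (f - u * f) + f * (u - v).
    by rewrite mulrBr (mulrC f u) (mulrC f v) addrA subrK.
  apply: le_trans (fourier_normD huf (hC _ _ hv)) _.
  by rewrite lee_fin (mulrC C) divfK ?gt_eqF //; lra.
(* Finite support of v puts this quotient in A(G). Where [gen] vanishes, so does every member of
   [I], hence f, and the value 0 given by division by zero is consistent. *)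
pose b y := v y * f y / gen y.
exists b.
  left; apply: fourier_algebra_finite; apply: finitely_supported_sub fv => x vx.
  by rewrite /b vx !mul0r.
apply/funext => y; rewrite (_ : (b * gen) y = v y * f y / gen y * gen y) //.
rewrite (_ : (v * f) y = v y * f y) //.
have [g0|g0] := eqVneq (gen y) 0; last by rewrite divfK.
have [->|fy] := eqVneq (f y) 0; first by rewrite mulr0 !mul0r.
have : gen y != 0 by rewrite gen_eq0 negbK; apply/asboolP; exists f.
by rewrite g0 eqxx.
Qed.

End ClosedIdeal.
End FourierAlgebra.

Theorem proposition3p1 (R : realType) (G : groupType)
    (hG : forall f : G -> R[i], @fourier_algebra R G f ->
       norm_closure (@fourier_algebra R G) (@fourier_norm R G)
         [set u * f | u in @fourier_algebra R G] f) :
  topologically_noetherian (@fourier_algebra R G) (@fourier_norm R G) <->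
  countable [set: G].
Proof.
split=> [|/countable_injP[num num_inj] I idI]; first exact: noetherian_countable.
have [|g Ig IE] := closed_ideal_singly_generated idI (num := num) _ hG.
  by move=> x y; apply: num_inj; rewrite inE.
exists 1%N, (fun=> g); split=> //; rewrite {1}IE.
congr (norm_closure _ _ _); apply/seteqP; split=> [_ [b Ab <-]|_ [b [Ab ->]]].
  by exists (fun=> b); rewrite big_ord1.
by exists (b ord0) => //; rewrite big_ord1.
Qed.
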